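(* Let $p$ and $q$ be probability distributions on $\Theta$ that are absolutely continuous with respect to Lebesgue measure, and let $d_\phi$ be the metric on $\Theta$ induced by an embedding $\phi:\Theta\to\mathbb R^m$ that satisfies the doubling condition with respect to Lebesgue measure. For a reference point $\theta_l\in\Theta$, define $B_r=\{\theta\in\Theta:d_\phi(\theta_l,\theta)\le r\}$ and, for $\theta^*\in\Theta$, define the ball probability rank under $q$ as $$U_q(\theta^* )=P_{\theta\sim q}\bigl(d_\phi(\theta_l,\theta)\le d_\phi(\theta_l,\theta^* )\bigr).$$ Then: (i) for each fixed $\theta_l\in\Theta$, the condition that $p(B_r)=q(B_r)$ for all radii $0\le r\le\sup_{\theta'\in\Theta}d_\phi(\theta',\theta_l)$ is equivalent to the statement that, when $\theta^*\sim p$, the random variable $U_q(\theta^* )$ is uniformly distributed on $[0,1]$; (ii) the condition that, for all choices of $\theta_l\in\Theta$, $U_q(\theta^* )\sim\mathrm{Unif}(0,1)$ under $\theta^*\sim p$, is both necessary and sufficient for $p=q$.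
   Context: $\Theta\subseteq\mathbb R^D$ is the (measurable) parameter space. The map $\phi:\Theta\to\mathbb R^m$ is measurable and $d_\phi(\theta_1,\theta_2)=\|\phi(\theta_1)-\phi(\theta_2)\|_2$ is a metric on $\Theta$. The $\phi$-ball is $B_\phi(\theta,R)=\{\theta'\in\Theta:\|\phi(\theta')-\phi(\theta)\|_2\le R\}$; $\phi$ satisfies the doubling condition with respect to Lebesgue measure $m$ if there is $C>0$ with $m(B_\phi(\theta,2R))\le C\,m(B_\phi(\theta,R))$ for all $\theta\in\Theta$ and all $R>0$. Equality $p=q$ means that the densities agree Lebesgue-almost everywhere. (In the application, $p$ and $q$ are $p(\cdot\mid x)$ and $q(\cdot\mid x)$ for a fixed conditioning input $x$.)
   Formalization: The implications ''equal ball masses ⇒ U_q uniform'' in (i) and ''p = q ⇒ U_q uniform'' in (ii) additionally assume that every sphere {θ : d_φ(θ_l,θ) = r} has q-probability zero (in (ii), for all θ_l); without this they fail, e.g. when φ runs along an arc centred at φ(θ_l). *)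

(* Defs.v *)
From HB Require Import structures.
From mathcomp Require Import all_boot all_order all_algebra.
From mathcomp Require Import all_classical all_reals all_analysis.
From mathcomp Require Import measurable_realfun.

Set Implicit Arguments.
Unset Strict Implicit.
Unset Printing Implicit Defensive.

Import Order.TTheory GRing.Theory Num.Theory.
Import numFieldNormedType.Exports.

Local Open Scope classical_set_scope.
Local Open Scope ring_scope.
Local Open Scope ereal_scope.

(* R^n is n.-tuple R with the library's product Borel sigma-algebra.
   Lebesgue measure on R^n by iterated integration (Cavalieri); see
   [lebesgue_tuple_box] for its values on boxes. *)
Fixpoint lebesgue_tuple (R : realType) (n : nat) :
    set (n.-tuple R) -> \bar R :=
  match n return set (n.-tuple R) -> \bar R with
  | 0 => fun A => \d_([tuple] : 0.-tuple R) A
  | n'.+1 => fun A => \int[lebesgue_measure]_x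
      lebesgue_tuple [set t : n'.-tuple R | A [tuple of x :: t]]
  end.

Lemma sigma_finite_product d1 d2 (T1 : measurableType d1)
    (T2 : measurableType d2) (R : realType)
    (m1 : {sigma_finite_measure set T1 -> \bar R})
    (m2 : {sigma_finite_measure set T2 -> \bar R}) :
  sigma_finite setT (m1 \x m2).
Proof.
have /sigma_finiteP[F [TF ndF Foo]] := sigma_finiteT m1.
have /sigma_finiteP[G [TG ndG Goo]] := sigma_finiteT m2.
exists (fun n => F n `*` G n).
  rewrite -setXTT TF TG predeqE => -[x y]; split.
    move=> [/= [n _ Fnx] [k _ Gky]]; exists (maxn n k) => //; split.
    - by move: x Fnx; exact/subsetPset/ndF/leq_maxl.
    - by move: y Gky; exact/subsetPset/ndG/leq_maxr.
  by move=> [n _ []/= ? ?]; split; exists n.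
move=> k; have [? ?] := Foo k; have [? ?] := Goo k.
split; first exact: measurableX.
by rewrite product_measure1E// lte_mul_pinfty// ge0_fin_numE.
Qed.

Section cons_measure.
Context (R : realType) (n : nat).
Variable mu : {sigma_finite_measure set (n.-tuple R) -> \bar R}.

Let f (z : measurableTypeR R * n.-tuple R) : n.+1.-tuple R :=
  [tuple of (z.1 : R) :: z.2].

Let mf : measurable_fun setT f.
Proof.
apply/measurable_fun_tnthP => i; case: (unliftP ord0 i) => [j ->|->].
  rewrite (_ : _ \o _ = (fun t => tnth t j) \o snd); last first.
    by apply/funext => z /=; rewrite tnthS.
  by apply: measurableT_comp => //; exact: measurable_tnth.
rewrite (_ : _ \o _ = fst)//.
Qed.

Let g (t : n.+1.-tuple R) : measurableTypeR R * n.-tuple R :=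
  ((thead t : measurableTypeR R), [tuple of behead t]).

Let fK : cancel f g.
Proof. by move=> [x t]; rewrite /f /g /=; congr pair; apply/val_inj. Qed.

Let gK : cancel g f.
Proof. by move=> t; rewrite /f /g /= -tuple_eta. Qed.

Let mg : measurable_fun setT g.
Proof.
by apply/measurable_fun_pairP; split;
  [exact: measurable_tnth|exact: measurable_behead].
Qed.

Definition cons_measure : set (n.+1.-tuple R) -> \bar R :=
  pushforward (lebesgue_measure \x mu) f.

Let cons0 : cons_measure set0 = 0.
Proof. by rewrite /cons_measure /pushforward preimage_set0 measure0. Qed.

Let cons_ge0 A : 0 <= cons_measure A.
Proof. exact: measure_ge0. Qed.

Let cons_sigma_additive : semi_sigma_additive cons_measure.
Proof.
move=> F mF tF mUF; rewrite /cons_measure /pushforward preimage_bigcup.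
apply: measure_semi_sigma_additive.
- by move=> k; rewrite -[X in measurable X]setTI; exact: mf.
- apply/trivIsetP => /= i j _ _ ij; rewrite -preimage_setI.
  by move/trivIsetP : tF => /(_ _ _ _ _ ij) ->//; rewrite preimage_set0.
- by rewrite -preimage_bigcup -[X in measurable X]setTI; exact: mf.
Qed.

HB.instance Definition _ := isMeasure.Build _ _ _ cons_measure
  cons0 cons_ge0 cons_sigma_additive.

Let cons_sigma_finite : sigma_finite setT cons_measure.
Proof.
have [F FT mF] : sigma_finite setT (lebesgue_measure \x mu).
  exact: sigma_finite_product.
exists (fun k => g @^-1` F k); first by rewrite -preimage_bigcup -FT.
move=> k; have [mFk Fk] := mF k; split.
  by rewrite -[X in measurable X]setTI; exact: mg.
by rewrite /cons_measure /pushforward -comp_preimage (_ : g \o f = id)//; apply/funext.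
Qed.

HB.instance Definition _ := Measure_isSigmaFinite.Build _ _ _ cons_measure
  cons_sigma_finite.

End cons_measure.
Lemma lebesgue_tuple_ex (R : realType) (n : nat) :
  exists mu : {sigma_finite_measure set (n.-tuple R) -> \bar R},
    forall A, lebesgue_tuple A = mu A.
Proof.
elim: n => [|n [mu muE]].
  by exists (dirac ([tuple] : 0.-tuple R)).
exists (cons_measure mu) => A /=.
apply: eq_integral => x _; rewrite muE /=; congr (mu _).
by rewrite /xsection; apply/seteqP; split => t /=; rewrite inE.
Qed.

Section lebesgue_tuple_measure.
Context (R : realType) (n : nat).
Local Notation leb := (@lebesgue_tuple R n).

Let leb0 : leb set0 = 0.
Proof. by have [mu muE] := lebesgue_tuple_ex R n; rewrite muE measure0. Qed.

Let leb_ge0 A : 0 <= leb A.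
Proof. by have [mu muE] := lebesgue_tuple_ex R n; rewrite muE. Qed.

Let leb_sigma_additive : semi_sigma_additive leb.
Proof.
have [mu muE] := lebesgue_tuple_ex R n.
rewrite (_ : lebesgue_tuple (n:=n) = mu); last exact/funext.
exact: measure_semi_sigma_additive.
Qed.

HB.instance Definition _ := isMeasure.Build _ _ _ leb
  leb0 leb_ge0 leb_sigma_additive.

Let leb_sigma_finite : sigma_finite setT leb.
Proof.
have [mu muE] := lebesgue_tuple_ex R n.
rewrite (_ : lebesgue_tuple (n:=n) = mu); last exact/funext.
exact: sigma_finiteT.
Qed.

HB.instance Definition _ := Measure_isSigmaFinite.Build _ _ _ leb
  leb_sigma_finite.

End lebesgue_tuple_measure.

Lemma lebesgue_tuple_box (R : realType) (n : nat) (a b : n.-tuple R) :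
  (forall i, (tnth a i <= tnth b i)%R) ->
  lebesgue_tuple [set t : n.-tuple R |
    forall i, (tnth a i <= tnth t i <= tnth b i)%R]
  = (\prod_(i < n) (tnth b i - tnth a i))%:E.
Proof.
elim: n a b => [a b _|n IH a b ab].
  rewrite big_ord0 /= diracE mem_set//=; by case.
set a' : n.-tuple R := [tuple of behead a].
set b' : n.-tuple R := [tuple of behead b].
have a'E i : tnth a' i = tnth a (lift ord0 i).
  by rewrite [in RHS](tuple_eta a) tnthS.
have b'E i : tnth b' i = tnth b (lift ord0 i).
  by rewrite [in RHS](tuple_eta b) tnthS.
have := IH a' b' _; set B := [set t : n.-tuple R | _].
have ab' : forall i, (tnth a' i <= tnth b' i)%R by move=> i; rewrite a'E b'E.
move=> /(_ ab') leB.
rewrite big_ord_recl /=.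
transitivity (\int[lebesgue_measure]_x
    ((\prod_(i < n) (tnth b' i - tnth a' i))%:E *
     (\1_(`[tnth a ord0, tnth b ord0]%classic : set (measurableTypeR R)) x)%:E)).
  apply: eq_integral => x _; rewrite indicE.
  have [/set_mem/=|/negP xab] := boolP (x \in _).
    rewrite in_itv /= => xab; rewrite mule1 -leB.
    congr (lebesgue_tuple _); apply/seteqP; split=> t /= tab i.
      by have := tab (lift ord0 i); rewrite tnthS a'E b'E.
    case: (unliftP ord0 i) => [j ->|->]; last by [].
    by have := tab j; rewrite tnthS a'E b'E.
  rewrite mule0 (_ : [set t | _] = set0) ?measure0//.
  apply/seteqP; split => // t /= /(_ ord0) tab.
  by apply: xab; rewrite inE/= in_itv.
rewrite ge0_integralZl//.
- rewrite integral_indic// setIT.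
  rewrite -[X in _ * X]/(lebesgue_measure
    (`[tnth a ord0, tnth b ord0]%classic : set R)).
  rewrite lebesgue_measure_itv /= lte_fin.
  rewrite (eq_bigr (fun i => tnth b (lift ord0 i) - tnth a (lift ord0 i))%R); last first.
    by move=> i _; rewrite a'E b'E.
  case: ltP => [_|ba].
    by rewrite -EFinB -EFinM mulrC.
  have -> : tnth b ord0 = tnth a ord0 by apply/eqP; rewrite eq_le ba ab.
  by rewrite subrr mul0r mule0.
- by apply/measurable_EFinP; exact: measurable_indic.
- by rewrite lee_fin prodr_ge0// => i _; rewrite subr_ge0.
Qed.

Definition dphi (R : realType) (D m : nat) (phi : D.-tuple R -> m.-tuple R)
    (t1 t2 : D.-tuple R) : R :=
  Num.sqrt (\sum_(i < m) (tnth (phi t1) i - tnth (phi t2) i) ^+ 2)%R.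

Definition is_metric_on (R : realType) (T : Type) (Theta : set T)
    (d : T -> T -> R) : Prop :=
  [/\ forall x y, Theta x -> Theta y -> (0 <= d x y)%R,
      forall x y, Theta x -> Theta y -> (d x y = 0%R <-> x = y),
      forall x y, Theta x -> Theta y -> d x y = d y x &
      forall x y z, Theta x -> Theta y -> Theta z ->
        (d x z <= d x y + d y z)%R].

Definition phi_ball (R : realType) (D m : nat) (Theta : set (D.-tuple R))
    (phi : D.-tuple R -> m.-tuple R) (t : D.-tuple R) (r : R) :
    set (D.-tuple R) :=
  [set t' | Theta t' /\ (dphi phi t t' <= r)%R].

(* The law of d_phi(tl, .) under q has no atom, i.e. r |-> q(B_r) is
   continuous.  Absolute continuity of q alone does not give this: a bi-Lipschitz
   curve phi may run along an arc of a circle centred at phi(tl). *)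
Definition atomless_distance (R : realType) (D m : nat)
    (Theta : set (D.-tuple R)) (phi : D.-tuple R -> m.-tuple R)
    (q : probability (D.-tuple R) R) (tl : D.-tuple R) : Prop :=
  forall r : R, q [set t | Theta t /\ dphi phi tl t = r] = 0.

Definition doubling (R : realType) (D m : nat) (Theta : set (D.-tuple R))
    (phi : D.-tuple R -> m.-tuple R) : Prop :=
  exists2 C : R, (0 < C)%R &
    forall (t : D.-tuple R) (r : R), Theta t -> (0 < r)%R ->
      lebesgue_tuple (phi_ball Theta phi t (2 * r)) <=
      C%:E * lebesgue_tuple (phi_ball Theta phi t r).

Definition ball_rank (R : realType) (D m : nat) (Theta : set (D.-tuple R))
    (phi : D.-tuple R -> m.-tuple R) (q : probability (D.-tuple R) R)
    (tl ts : D.-tuple R) : R :=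
  fine (q (phi_ball Theta phi tl (dphi phi tl ts))).

(* The law of U under p, where p is carried by Theta and U is only meaningful
   on Theta. *)
Definition uniform01_under (R : realType) (D : nat) (Theta : set (D.-tuple R))
    (p : probability (D.-tuple R) R) (U : D.-tuple R -> R) : Prop :=
  forall A : set R, measurable A ->
    p (Theta `&` U @^-1` A) = uniform_prob (@ltr01 R) A.

(* The supremum is taken in the extended reals: it is +oo when d_phi is
   unbounded from tl. *)
Definition same_ball_mass (R : realType) (D m : nat) (Theta : set (D.-tuple R))
    (phi : D.-tuple R -> m.-tuple R) (p q : probability (D.-tuple R) R)
    (tl : D.-tuple R) : Prop :=
  forall r : R, (0 <= r)%R ->
    r%:E <= ereal_sup [set (dphi phi t' tl)%:E | t' in Theta] ->
    p (phi_ball Theta phi tl r) = q (phi_ball Theta phi tl r).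

Local Open Scope charge_scope.

Definition same_density (R : realType) (D : nat) (Theta : set (D.-tuple R))
    (p q : probability (D.-tuple R) R) : Prop :=
  ('d (charge_of_finite_measure p) '/d (@lebesgue_tuple R D))
  = ('d (charge_of_finite_measure q) '/d (@lebesgue_tuple R D))
  %[ae (@lebesgue_tuple R D) in Theta].

(* Main.v *)
(** Part (i) is the probability integral transform for the law of the distance
    to [tl]. For (ii), let [s = p - q]. Equal masses of all balls centred in
    [Theta] make [s] integrate to 0 every function of [d_phi x], [x] in
    [Theta], in particular [fun y => exp(- c |phi x - phi y|^2)]. Integrating
    this once more against [s] and expanding [exp(2 c <phi x, phi y>)] in powers
    gives 0 as a sum of squares of the Gaussian-weighted moments of [phi] under
    [s], so these vanish, and so do the integrals of all
    [exp(- c |phi|^2 + <a, phi> + b)]. Such functions are closed under products,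
    and exponentials of their sums converge boundedly to indicators of orthants:
    [phi] has the same law under [p] and [q]. Finally, compact subsets of the
    graph of the injective map [phi] show that preimages of Borel sets under
    [phi] approximate every Borel subset of [Theta] from inside. *)

Require Import Defs.
From mathcomp Require Import all_boot all_order all_algebra.
From mathcomp Require Import all_classical all_reals all_analysis.
From mathcomp Require Import measurable_realfun.
From mathcomp Require Import ring lra.

Import Order.TTheory GRing.Theory Num.Theory.
Import numFieldNormedType.Exports.

Set Implicit Arguments.
Unset Strict Implicit.
Unset Printing Implicit Defensive.

Local Open Scope classical_set_scope.
Local Open Scope ring_scope.

(** * Generators of the Borel sigma-algebra on tuples *)

Section tuple_sigma_algebra.
Context (R : realType) (n : nat).

(** The product sigma-algebra is generated by the coordinates. For fixed [i], the real sets whose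
    preimage under coordinate [i] lies in [S] form a sigma-algebra, so rays are enough to capture
    every Borel set. *)
Lemma measurable_tuple_ind (S : set (set (n.-tuple R))) :
  sigma_algebra setT S ->
  (forall i c, S [set t | tnth t i <= c]) ->
  measurable `<=` S.
Proof.
move=> sS raysS.
have [S0 SC SU] := sS.
apply: smallest_sub => //; rewrite -bigcup_seq => A /= [i _ [B mB <-]].
rewrite setTI.
pose S_i := [set B : set R | S ((fun t : n.-tuple R => tnth t i) @^-1` B)].
suff : measurable `<=` S_i by apply.
rewrite -[X in X `<=` _]/((@ocitv R).-sigma.-measurable) RGenOInfty.measurableE.
apply: smallest_sub => [|_ [x ->]].
  split.
  - by rewrite /S_i/= preimage_set0.
  - by move=> C SC'; rewrite /S_i/= setTD preimage_setC -setTD; exact: SC.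
  - by move=> F SF; rewrite /S_i/= preimage_bigcup; exact: SU.
rewrite /S_i/= (_ : _ @^-1` _ = setT `\` [set t : n.-tuple R | tnth t i <= x]).
  by apply: SC; exact: raysS.
apply/seteqP; split => t /=; rewrite in_itv/= andbT.
  by move=> xt; split=> //; apply/negP; rewrite -ltNge.
by move=> -[_ /negP]; rewrite -ltNge.
Qed.

(* Indexing orthants by lists of constraints makes them a pi-system: the
   intersection is the concatenation. *)
Definition orthant (s : seq ('I_n * R)) : set (n.-tuple R) :=
  [set t | all (fun ic => tnth t ic.1 <= ic.2) s].

Lemma measurable_orthant s : measurable (orthant s).
Proof.
elim: s => [|[i c] s IH].
  by rewrite (_ : orthant [::] = setT)//; apply/seteqP; split.
rewrite (_ : orthant _ = (fun t => tnth t i) @^-1` `]-oo, c] `&` orthant s).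
  apply: measurableI => //; rewrite -[X in measurable X]setTI.
  exact: measurable_tnth.
apply/seteqP; split => t; rewrite /orthant/= in_itv/=.
  by move=> /andP[].
by move=> [-> ->].
Qed.

Lemma finite_measure_unique_orthant (m1 m2 : {measure set (n.-tuple R) -> \bar R}) :
  (m1 setT < +oo)%E ->
  (forall s, m1 (orthant s) = m2 (orthant s)) ->
  forall A, measurable A -> m1 A = m2 A.
Proof.
move=> m1oo m12 A mA.
(* The empty list of constraints gives [setT], so the constant sequence is an exhaustion inside the
   pi-system. *)
apply: (measure_unique (range orthant) (fun=> setT)) => //.
- apply/seteqP; split.
    apply: measurable_tuple_ind; first exact: smallest_sigma_algebra.
    move=> i c; apply: sub_sigma_algebra; exists [:: (i, c)] => //.
    by apply/seteqP; split => t; rewrite /orthant/= andbT.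
  apply: smallest_sub; first exact: sigma_algebra_measurable.
  by move=> _ [s _ <-]; exact: measurable_orthant.
- move=> _ _ [s _ <-] [s' _ <-]; exists (s ++ s') => //.
  apply/seteqP; split => t; rewrite /orthant/= all_cat; first by move/andP.
  by move=> [-> ->].
- by move=> _; exists [::] => //; apply/seteqP; split.
- by rewrite bigcup_const//; exists 0%N.
- by move=> _ [s _ <-].
Qed.

End tuple_sigma_algebra.

(** * Integration against the difference of two probabilities *)

Section gap.
Context d (T : measurableType d) (R : realType).
Variables (Theta : set T) (mTheta : measurable Theta).

(** A class of functions integrable under every probability and stable under sums and products; it
    carries the side conditions of linearity and dominated convergence below. *)
Definition bounded_mfun (f : T -> R) :=
  measurable_fun Theta f /\ exists M, forall x, Theta x -> `|f x| <= M.

Lemma bounded_mfun_integrable (mu : probability T R) f :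
  bounded_mfun f -> mu.-integrable Theta (EFin \o f).
Proof.
move=> [mf [M fM]]; apply: measurable_bounded_integrable => //.
  by rewrite (le_lt_trans (probability_le1 mu mTheta))// ltry.
exists M; split; first exact: num_real.
by move=> y My x Tx /=; rewrite (le_trans (fM x Tx))// ltW.
Qed.

Lemma bounded_mfun_cst c : bounded_mfun (fun=> c).
Proof. by split; [exact: measurable_cst|exists `|c|]. Qed.

Lemma bounded_mfunD f g :
  bounded_mfun f -> bounded_mfun g -> bounded_mfun (fun x => f x + g x).
Proof.
move=> [mf [M fM]] [mg [N gN]]; split; first exact: measurable_funD.
exists (M + N) => x Tx; rewrite (le_trans (ler_normD _ _))// lerD//.
  exact: fM.
exact: gN.
Qed.

Lemma bounded_mfunM f g :
  bounded_mfun f -> bounded_mfun g -> bounded_mfun (fun x => f x * g x).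
Proof.
move=> [mf [M fM]] [mg [N gN]]; split; first exact: measurable_funM.
exists (M * N) => x Tx; rewrite normrM ler_pM//.
  exact: fM.
exact: gN.
Qed.

Lemma bounded_mfunZ c f : bounded_mfun f -> bounded_mfun (fun x => c * f x).
Proof. by move=> bf; apply: bounded_mfunM => //; exact: bounded_mfun_cst. Qed.

Lemma bounded_mfun_sum I (r : seq I) (P : pred I) (f : I -> T -> R) :
  (forall i, bounded_mfun (f i)) ->
  bounded_mfun (fun x => \sum_(i <- r | P i) f i x).
Proof.
move=> bf; elim: r => [|i r IH].
  rewrite (_ : (fun _ => _) = fun=> 0); first exact: bounded_mfun_cst.
  by apply/funext => x; rewrite big_nil.
rewrite (_ : (fun _ => _) = fun x =>
    if P i then f i x + \sum_(i <- r | P i) f i x else \sum_(i <- r | P i) f i x).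
  by case: (P i) => //; apply: bounded_mfunD.
by apply/funext => x; rewrite big_cons.
Qed.

Variables p q : probability T R.

(** The integral over [Theta] against the signed measure [p - q]. *)
Definition gap (f : T -> R) : R :=
  \int[p]_(x in Theta) f x - \int[q]_(x in Theta) f x.

Lemma eq_gap f g : (forall x, Theta x -> f x = g x) -> gap f = gap g.
Proof.
by move=> fg; congr (_ - _); apply: eq_Rintegral => x /set_mem; exact: fg.
Qed.

Lemma gapD f g : bounded_mfun f -> bounded_mfun g ->
  gap (fun x => f x + g x) = gap f + gap g.
Proof.
move=> bf bg; rewrite /gap !RintegralD//; try exact: bounded_mfun_integrable.
by rewrite opprD addrACA.
Qed.

Lemma gapZ c f : bounded_mfun f -> gap (fun x => c * f x) = c * gap f.
Proof.
move=> bf; rewrite /gap !RintegralZl//; try exact: bounded_mfun_integrable.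
by rewrite mulrBr.
Qed.

Lemma gap0 : gap (fun=> 0) = 0.
Proof. by rewrite /gap !Rintegral_cst// !mul0r subrr. Qed.

Lemma gap_cst c : p Theta = q Theta -> gap (fun=> c) = 0.
Proof.
move=> pq; have {}pq : fine (p Theta) = fine (q Theta) by rewrite pq.
by rewrite /gap !Rintegral_cst// pq subrr.
Qed.

Lemma gap_sum I (r : seq I) (P : pred I) (f : I -> T -> R) :
  (forall i, bounded_mfun (f i)) ->
  gap (fun x => \sum_(i <- r | P i) f i x) = \sum_(i <- r | P i) gap (f i).
Proof.
move=> bf; elim: r => [|i r IH].
  by rewrite big_nil -[RHS]gap0; apply: eq_gap => x _; rewrite big_nil.
rewrite big_cons -IH; case: ifPn => Pi.
  rewrite -gapD//; last exact: bounded_mfun_sum.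
  by apply: eq_gap => x _; rewrite big_cons Pi.
by apply: eq_gap => x _; rewrite big_cons (negbTE Pi).
Qed.

Lemma Rintegral_prob_le (mu : probability T R) f M : 0 <= M -> bounded_mfun f ->
  (forall x, Theta x -> `|f x| <= M) -> `|\int[mu]_(x in Theta) f x| <= M.
Proof.
move=> M0 bf fM; have intf := bounded_mfun_integrable mu bf.
rewrite (le_trans (le_normr_Rintegral mTheta intf))//.
apply: (@le_trans _ _ (\int[mu]_(x in Theta) M)).
  apply: le_Rintegral => //.
    apply: (@bounded_mfun_integrable mu (fun x => `|f x|)).
    case: bf => mf _; split; first exact: measurableT_comp.
    by exists M => x Tx; rewrite normr_id fM.
  exact: (bounded_mfun_integrable mu (bounded_mfun_cst M)).
rewrite Rintegral_cst// ler_piMr//.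
rewrite -lee_fin fineK ?probability_le1// ge0_fin_numE//.
by rewrite (le_lt_trans (probability_le1 mu mTheta))// ltry.
Qed.

Lemma gap_le f M : 0 <= M -> bounded_mfun f ->
  (forall x, Theta x -> `|f x| <= M) -> `|gap f| <= M + M.
Proof.
move=> M0 bf fM; rewrite (le_trans (ler_normB _ _))// lerD//;
  exact: Rintegral_prob_le.
Qed.

Lemma Rintegral_prob_cvg (mu : probability T R) (f_ : nat -> T -> R) f M :
  (forall n, measurable_fun Theta (f_ n)) ->
  (forall n x, Theta x -> `|f_ n x| <= M) ->
  (forall x, Theta x -> f_ ^~ x @ \oo --> f x) ->
  \int[mu]_(x in Theta) f_ n x @[n --> \oo] --> \int[mu]_(x in Theta) f x.
Proof.
move=> mf_ fM f_f.
have mf : measurable_fun Theta f.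
  exact: (measurable_fun_cvg (h:=f_)).
have cf : {ae mu, forall x, Theta x -> (EFin \o f_ n) x @[n --> \oo] --> (EFin \o f) x}.
  apply: aeW => x Tx; apply: cvg_EFin; first exact: nearW.
  exact: f_f.
have bf : {ae mu, forall x n, Theta x -> (`|(EFin \o f_ n) x| <= M%:E)%E}.
  by apply: aeW => x n Tx; rewrite lee_fin fM.
have [intf _ intf_f] := dominated_convergence mTheta
  (fun n => (measurable_EFinP _ _).2 (mf_ n)) ((measurable_EFinP _ _).2 mf) cf
  (bounded_mfun_integrable mu (bounded_mfun_cst M)) bf.
apply: fine_cvg; rewrite fineK//; exact: integrable_fin_num.
Qed.

Lemma gap_cvg (f_ : nat -> T -> R) f M :
  (forall n, measurable_fun Theta (f_ n)) ->
  (forall n x, Theta x -> `|f_ n x| <= M) ->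
  (forall x, Theta x -> f_ ^~ x @ \oo --> f x) ->
  gap (f_ n) @[n --> \oo] --> gap f.
Proof.
by move=> mf fM f_f; apply: cvgB; apply: Rintegral_prob_cvg fM f_f.
Qed.

End gap.

(** * Gaussian-weighted moments *)

Section exp_partial_sum.
Context (R : realType).

Definition exp_psum (n : nat) (u : R) : R := \sum_(k < n) u ^+ k / k`!%:R.

Lemma cvg_exp_psum u : exp_psum n u @[n --> \oo] --> expR u.
Proof.
have /cvg_ex[l ul] := is_cvg_series_exp_coeff u.
rewrite (_ : (fun _ => _) = series (exp_coeff u)).
  exact: is_cvg_series_exp_coeff.
by apply/funext => n; rewrite /exp_psum /series/= big_mkord.
Qed.

(** The triangle inequality reduces to [|u|], where the partial sums increase to the exponential.
    This bound, uniform in [n], provides the domination whenever an exponential is expanded. *)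
Lemma exp_psum_norm n u : `|exp_psum n u| <= expR `|u|.
Proof.
apply: (@le_trans _ _ (exp_psum n `|u|)).
  rewrite (le_trans (ler_norm_sum _ _ _))// ler_sum// => k _.
  by rewrite normrM normrX normfV normr_nat.
have := @cvg_exp_psum `|u|; set e := exp_psum^~ _ => eu.
rewrite -(cvg_lim _ eu)//; apply: nondecreasing_cvgn_le; last first.
  by apply/cvg_ex; eexists; exact: eu.
apply/nondecreasing_seqP => k; rewrite /e /exp_psum big_ord_recr/= lerDl.
by rewrite divr_ge0// exprn_ge0.
Qed.

(** A single term of the exponential series is at most the sum, all terms being nonnegative. *)
Lemma exprn_le_expR k (u : R) : 0 <= u -> u ^+ k <= k`!%:R * expR u.
Proof.
move=> u0; rewrite mulrC -ler_pdivrMr ?ltr0n ?fact_gt0//.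
have := exp_psum_norm k.+1 u; rewrite (ger0_norm u0); apply: le_trans.
rewrite /exp_psum big_ord_recr/= (le_trans _ (ler_norm _))// lerDr.
by apply: sumr_ge0 => i _; rewrite divr_ge0// exprn_ge0.
Qed.

End exp_partial_sum.

Section tuple_vectors.
Context (R : realType) (m : nat).
Implicit Types x y : m.-tuple R.

Definition dot x y : R := \sum_(i < m) tnth x i * tnth y i.

(** Termwise from the squares of the sum and the difference. It is what lets Gaussian factors absorb
    exponentials of inner products. *)
Lemma dot_norm_le x y : `|dot x y| <= (dot x x + dot y y) / 2.
Proof.
rewrite (le_trans (ler_norm_sum _ _ _))// -big_split/= mulr_suml ler_sum// => i _.
by rewrite ler_norml; have := sqr_ge0 (tnth x i + tnth y i);
  have := sqr_ge0 (tnth x i - tnth y i); lra.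
Qed.

Lemma dot_ge0 x : 0 <= dot x x.
Proof. by apply: sumr_ge0 => i _; rewrite -expr2 sqr_ge0. Qed.

(** Monomials are indexed by words of length [k] rather than by multi-indices, so that powers of
    [dot] expand without multinomial coefficients. *)
Definition monom k (a : {ffun 'I_k -> 'I_m}) x : R := \prod_(j < k) tnth x (a j).

Lemma dotX x y k : dot x y ^+ k = \sum_(a : {ffun 'I_k -> 'I_m}) monom a x * monom a y.
Proof.
transitivity (\prod_(j < k) dot x y).
  by rewrite prodr_const card_ord.
rewrite /dot bigA_distr_bigA/=; apply: eq_bigr => a _.
by rewrite /monom -big_split.
Qed.

(** With [S] the l1 norm of [x], the monomial is at most [S ^+ k], hence at most [k!] times the
    exponential of [S]; and [S] is at most [(m + dot x x) / 2] since each [|x_i|] is at most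
    [(1 + x_i^2) / 2]. *)
Lemma monom_norm_le k (a : {ffun 'I_k -> 'I_m}) x :
  `|monom a x| <= k`!%:R * expR (m%:R / 2) * expR (dot x x / 2).
Proof.
pose S := \sum_(i < m) `|tnth x i|.
have S0 : 0 <= S by exact: sumr_ge0.
apply: (@le_trans _ _ (S ^+ k)).
  rewrite normr_prod (_ : S ^+ k = \prod_(j < k) S); last first.
    by rewrite prodr_const card_ord.
  apply: ler_prod => j _; rewrite normr_ge0/= /S (bigD1 (a j))//= lerDl.
  exact: sumr_ge0.
rewrite (le_trans (exprn_le_expR k S0))// -mulrA ler_pM2l ?ltr0n ?fact_gt0//.
rewrite -expRD ler_expR /S -mulrDl.
rewrite -[X in X%:R]card_ord -sum1_card natr_sum -big_split/= mulr_suml.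
apply: ler_sum => i _.
have := sqr_ge0 (`|tnth x i| - 1); have := real_normK (num_real (tnth x i)).
by move=> ? ?; lra.
Qed.

End tuple_vectors.

Section moments.
Context d (T : measurableType d) (R : realType) (m : nat).
Variables (Theta : set T) (mTheta : measurable Theta) (p q : probability T R).
Variables (X : T -> m.-tuple R).
Hypothesis mX : forall i, measurable_fun Theta (fun t => tnth (X t) i).

Local Notation gap := (gap Theta p q).
Local Notation bounded_mfun := (bounded_mfun Theta).

Definition gauss (t : T) : R := expR (- (dot (X t) (X t) / 2)).

Lemma measurable_dotr (f : T -> m.-tuple R) (g : T -> m.-tuple R) :
  (forall i, measurable_fun Theta (fun t => tnth (f t) i)) ->
  (forall i, measurable_fun Theta (fun t => tnth (g t) i)) ->
  measurable_fun Theta (fun t => dot (f t) (g t)).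
Proof.
by move=> mf mg; apply: measurable_sum => i; exact: measurable_funM.
Qed.

Lemma measurable_gauss : measurable_fun Theta gauss.
Proof.
apply: measurableT_comp => //; apply: measurableT_comp => //.
by apply: measurable_funM => //; exact: measurable_dotr.
Qed.

Definition gmonom k (a : {ffun 'I_k -> 'I_m}) (t : T) : R :=
  monom a (X t) * gauss t.

Lemma bounded_gmonom k (a : {ffun 'I_k -> 'I_m}) : bounded_mfun (gmonom a).
Proof.
split.
  apply: measurable_funM; last exact: measurable_gauss.
  by apply: measurable_prod => j _; exact: mX.
exists (k`!%:R * expR (m%:R / 2)) => t _.
rewrite normrM (ger0_norm (expR_ge0 _)) /gauss expRN ler_pdivrMr ?expR_gt0//.
exact: monom_norm_le.
Qed.

Hypothesis gapK : forall x, Theta x ->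
  gap (fun y => expR (- (\sum_(i < m) (tnth (X x) i - tnth (X y) i) ^+ 2) / 2)) = 0.

(** The Gaussian kernel [exp (- |X x - X y|^2 / 2)] factors as [gauss x * gauss y * exp <X x, X y>];
    truncating the last factor leaves a finite sum of products of a function of [x] and a function
    of [y]. *)
Let h n (x y : T) := gauss x * gauss y * exp_psum n (dot (X x) (X y)).

Let hE n x y : h n x y =
  \sum_(k < n) \sum_(a : {ffun 'I_k -> 'I_m}) (k`!%:R^-1 * gmonom a x) * gmonom a y.
Proof.
rewrite /h /exp_psum mulr_sumr; apply: eq_bigr => k _.
rewrite dotX mulr_suml mulr_sumr; apply: eq_bigr => a _.
by rewrite /gmonom; ring.
Qed.

Let h_le1 n x y : `|h n x y| <= 1.
Proof.
rewrite !normrM !(ger0_norm (expR_ge0 _)).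
apply: (@le_trans _ _ (gauss x * gauss y * expR `|dot (X x) (X y)|)).
  by rewrite ler_wpM2l ?exp_psum_norm// mulr_ge0// expR_ge0.
rewrite -!expRD expR_le1; have := dot_norm_le (X x) (X y); lra.
Qed.

Let bounded_h n x : bounded_mfun (h n x).
Proof.
rewrite (_ : h n x = fun y => \sum_(k < n) \sum_(a : {ffun 'I_k -> 'I_m})
  (k`!%:R^-1 * gmonom a x) * gmonom a y); last by apply/funext => y; rewrite hE.
apply: bounded_mfun_sum => k; apply: bounded_mfun_sum => a.
by apply: bounded_mfunZ; exact: bounded_gmonom.
Qed.

Let cvg_h x y : h n x y @[n --> \oo] -->
  expR (- (\sum_(i < m) (tnth (X x) i - tnth (X y) i) ^+ 2) / 2).
Proof.
rewrite (_ : expR _ = gauss x * gauss y * expR (dot (X x) (X y))); last first.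
  rewrite -!expRD; congr expR; rewrite -!mulNr -mulrDl.
  rewrite -[X in _ = _ + X](@mulfK _ 2)// -mulrDl; congr (_ / _).
  rewrite /dot -!sumrN mulr_suml -!big_split/=; apply: eq_bigr => i _.
  by ring.
by apply: cvgM; [exact: cvg_cst|exact: cvg_exp_psum].
Qed.

Let u n x := gap (h n x).

Let uE n x : u n x = \sum_(k < n) \sum_(a : {ffun 'I_k -> 'I_m})
  (k`!%:R^-1 * gap (gmonom a)) * gmonom a x.
Proof.
rewrite /u (@eq_gap _ _ _ _ _ _ _ (fun y => \sum_(k < n) \sum_(a : {ffun 'I_k -> 'I_m})
  (k`!%:R^-1 * gmonom a x) * gmonom a y)); last by move=> y _; rewrite hE.
have bZ c k (a : {ffun 'I_k -> 'I_m}) : bounded_mfun (fun y => c * gmonom a y).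
  by apply: bounded_mfunZ; exact: bounded_gmonom.
rewrite gap_sum//; last by move=> k; exact: bounded_mfun_sum.
apply: eq_bigr => k _; rewrite gap_sum//; apply: eq_bigr => a _.
by rewrite gapZ//; [ring|exact: bounded_gmonom].
Qed.

(* The two-fold gap of the partial sums [h n] is the sum over k < n of
   (k!)^-1 (gap (gmonom a))^2; it increases with n and tends to 0. *)
Lemma gap_gmonom k (a : {ffun 'I_k -> 'I_m}) : gap (gmonom a) = 0.
Proof.
have bZ c l (b : {ffun 'I_l -> 'I_m}) : bounded_mfun (fun y => c * gmonom b y).
  by apply: bounded_mfunZ; exact: bounded_gmonom.
have bu n : bounded_mfun (u n).
  rewrite (_ : u n = fun x => \sum_(k < n) \sum_(a : {ffun 'I_k -> 'I_m})
    (k`!%:R^-1 * gap (gmonom a)) * gmonom a x); last by apply/funext => x; rewrite uE.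
  by apply: bounded_mfun_sum => l; apply: bounded_mfun_sum => b.
have gapu n : gap (u n) = \sum_(k < n) \sum_(a : {ffun 'I_k -> 'I_m})
    k`!%:R^-1 * gap (gmonom a) ^+ 2.
  rewrite (@eq_gap _ _ _ _ _ _ _ (fun x => \sum_(k < n) \sum_(a : {ffun 'I_k -> 'I_m})
    (k`!%:R^-1 * gap (gmonom a)) * gmonom a x)); last by move=> x _; rewrite uE.
  rewrite gap_sum//; last by move=> l; exact: bounded_mfun_sum.
  apply: eq_bigr => l _; rewrite gap_sum//; apply: eq_bigr => b _.
  by rewrite gapZ//; [ring|exact: bounded_gmonom].
(* Dominated convergence is used twice: in [y] with bound 1, where the limit vanishes by [gapK],
   then in [x] with bound 2. *)
have : gap (u n) @[n --> \oo] --> gap (fun=> 0).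
  apply: (@gap_cvg _ _ _ _ mTheta _ _ _ _ (1 + 1)).
  - by move=> n; case: (bu n).
  - by move=> n x _; exact: gap_le.
  - move=> x Tx; rewrite -(gapK Tx); apply: (@gap_cvg _ _ _ _ mTheta _ _ _ _ 1).
    + by move=> n; case: (bounded_h n x).
    + by move=> n y _; exact: h_le1.
    + by move=> y _; exact: cvg_h.
rewrite gap0// => u0.
have : k`!%:R^-1 * gap (gmonom a) ^+ 2 <= 0.
  apply: (cvgr_to_ge u0); near=> n.
  have kn : (k < n)%N by near: n; exact: nbhs_infty_gt.
  have t0 l (b : {ffun 'I_l -> 'I_m}) : 0 <= l`!%:R^-1 * gap (gmonom b) ^+ 2.
    by rewrite mulr_ge0// sqr_ge0.
  rewrite gapu (bigD1 (Ordinal kn))//= (bigD1 a)//= -addrA lerDl addr_ge0//.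
    exact: sumr_ge0.
  by apply: sumr_ge0 => l _; exact: sumr_ge0.
rewrite pmulr_rle0 ?invr_gt0 ?ltr0n ?fact_gt0// => g0.
by apply/eqP; rewrite -sqrf_eq0 eq_le g0 sqr_ge0.
Unshelve. all: by end_near. Qed.

(** The exponential expands into monomials, each of zero gap once weighted; the Gaussian keeps all
    partial sums below [exp (|b|^2 / 2)]. *)
Lemma gap_gauss_exp (b : m.-tuple R) :
  gap (fun t => gauss t * expR (dot b (X t))) = 0.
Proof.
have bZ c l (a : {ffun 'I_l -> 'I_m}) : bounded_mfun (fun y => c * gmonom a y).
  by apply: bounded_mfunZ; exact: bounded_gmonom.
have E n t : gauss t * exp_psum n (dot b (X t)) =
    \sum_(k < n) \sum_(a : {ffun 'I_k -> 'I_m}) (monom a b / k`!%:R) * gmonom a t.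
  rewrite /exp_psum mulr_sumr; apply: eq_bigr => k _.
  rewrite dotX mulr_suml mulr_sumr; apply: eq_bigr => a _.
  by rewrite /gmonom; ring.
have : gap (fun t => gauss t * exp_psum n (dot b (X t))) @[n --> \oo] -->
    gap (fun t => gauss t * expR (dot b (X t))).
  apply: (@gap_cvg _ _ _ _ mTheta _ _ _ _ (expR (dot b b / 2))).
  - move=> n; rewrite (_ : (fun _ => _) = fun t => \sum_(k < n)
      \sum_(a : {ffun 'I_k -> 'I_m}) (monom a b / k`!%:R) * gmonom a t); last exact/funext.
    apply: measurable_sum => k; apply: measurable_sum => a.
    by have [] := bZ (monom a b / k`!%:R) k a.
  - move=> n t _; rewrite normrM (ger0_norm (expR_ge0 _)).
    apply: (@le_trans _ _ (gauss t * expR `|dot b (X t)|)).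
      by rewrite ler_wpM2l ?exp_psum_norm// expR_ge0.
    by rewrite -expRD ler_expR; have := dot_norm_le b (X t); lra.
  - by move=> t _; apply: cvgM; [exact: cvg_cst|exact: cvg_exp_psum].
rewrite (_ : (fun n => _) = fun=> 0).
  by move=> /(cvg_lim (@Rhausdorff R)) <-; rewrite lim_cst.
apply/funext => n.
rewrite (@eq_gap _ _ _ _ _ _ _ (fun t => \sum_(k < n) \sum_(a : {ffun 'I_k -> 'I_m})
  (monom a b / k`!%:R) * gmonom a t)); last by move=> t _; rewrite E.
rewrite gap_sum//; last by move=> l; exact: bounded_mfun_sum.
apply: big1 => k _; rewrite gap_sum//; apply: big1 => a _.
by rewrite gapZ ?gap_gmonom ?mulr0//; exact: bounded_gmonom.
Qed.

End moments.

(** * Orthants as limits of Gaussian exponentials *)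

Section gaussian_separation.
Context d (T : measurableType d) (R : realType) (m : nat).
Variables (Theta : set T) (mTheta : measurable Theta) (p q : probability T R).
Hypothesis pq_Theta : p Theta = q Theta.
Variables (X : T -> m.-tuple R).
Hypothesis mX : forall i, measurable_fun Theta (fun t => tnth (X t) i).
Hypothesis gapK : forall (c : R) x, 0 <= c -> Theta x ->
  gap Theta p q (fun y =>
    expR (- (c * \sum_(i < m) (tnth (X x) i - tnth (X y) i) ^+ 2))) = 0.

Local Notation gap := (gap Theta p q).
Local Notation bounded_mfun := (bounded_mfun Theta).

(** [w] holds the linear coefficient and the constant of the exponent. The quadratic coefficient [s]
    is kept apart because all terms of a [gexp_sum] share it. *)
Definition gexp (s : R) (w : m.-tuple R * R) (t : T) : R :=
  expR (- (s * dot (X t) (X t)) + dot w.1 (X t) + w.2).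

Let scale (c : R) (v : m.-tuple R) : m.-tuple R := [tuple c * tnth v i | i < m].

Let dot_scale a b v w : dot (scale a v) (scale b w) = a * b * dot v w.
Proof.
by rewrite /dot mulr_sumr; apply: eq_bigr => i _; rewrite !tnth_mktuple; ring.
Qed.

(** Rescaling [X] by the square root of [2 * s] turns the quadratic part into [gauss]; the linear
    coefficient is rescaled inversely. *)
Let gexpE (s : R) w t : 0 < s -> gexp s w t = expR w.2 *
  (gauss (scale (Num.sqrt (2 * s)) \o X) t *
   expR (dot (scale (Num.sqrt (2 * s))^-1 w.1) (scale (Num.sqrt (2 * s)) (X t)))).
Proof.
move=> s0; rewrite /gexp /gauss/= !dot_scale -expr2 sqr_sqrtr; last first.
  by rewrite mulr_ge0// ltW.
rewrite mulVf ?gt_eqF ?sqrtr_gt0 ?mulr_gt0// mul1r -!expRD; congr expR.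
by field.
Qed.

Let mscale c i : measurable_fun Theta (fun t => tnth (scale c (X t)) i).
Proof.
rewrite (_ : (fun _ => _) = fun t => c * tnth (X t) i).
  exact: measurable_funM.
by apply/funext => t; rewrite tnth_mktuple.
Qed.

Lemma bounded_gexp (s : R) w : 0 < s -> bounded_mfun (gexp s w).
Proof.
move=> s0; split.
  apply: measurableT_comp => //; apply: measurable_funD => //.
  apply: measurable_funD; last exact: measurable_dotr.
  by apply: measurableT_comp => //; apply: measurable_funM => //; exact: measurable_dotr.
set b := scale (Num.sqrt (2 * s))^-1 w.1.
exists (expR w.2 * expR (dot b b / 2)) => t _.
rewrite ger0_norm ?expR_ge0// gexpE// ler_wpM2l ?expR_ge0//.
rewrite -expRD ler_expR; have := dot_norm_le b (scale (Num.sqrt (2 * s)) (X t)).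
have := ler_norm (dot b (scale (Num.sqrt (2 * s)) (X t))).
by rewrite -/b /=; move=> ? ?; lra.
Qed.

Lemma gap_gexp (s : R) w : 0 < s -> gap (gexp s w) = 0.
Proof.
move=> s0; set c := Num.sqrt (2 * s).
have c2 : c ^+ 2 = 2 * s by rewrite sqr_sqrtr// mulr_ge0// ltW.
(* Half the squared distance between rescaled points is [s] times the original squared distance, so
   this is [gapK] at the constant [s]. *)
have gK x : Theta x -> gap (fun y => expR (- (\sum_(i < m)
    (tnth ((scale c \o X) x) i - tnth ((scale c \o X) y) i) ^+ 2) / 2)) = 0.
  move=> Tx; apply: (etrans _ (gapK (ltW s0) Tx)); apply: eq_gap => y _; congr expR.
  rewrite mulNr; congr (- _). rewrite mulr_sumr mulr_suml.
  apply: eq_bigr => i _; rewrite /= !tnth_mktuple -mulrBr exprMn c2.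
  by field.
have g0 := gap_gauss_exp mTheta (mscale c) gK (scale c^-1 w.1).
rewrite (@eq_gap _ _ _ _ _ _ _ (fun t => expR w.2 * (gauss (scale c \o X) t *
   expR (dot (scale c^-1 w.1) ((scale c \o X) t))))); last by move=> t _; rewrite gexpE.
rewrite gapZ// ?g0 ?mulr0//.
rewrite (_ : (fun _ => _) = fun t => (expR w.2)^-1 * gexp s w t).
  by apply: bounded_mfunZ; exact: bounded_gexp.
by apply/funext => t; rewrite gexpE// mulKf// gt_eqF// expR_gt0.
Qed.

Definition gexp_sum (s : R) (L : seq (m.-tuple R * R)) (t : T) : R :=
  \sum_(w <- L) gexp s w t.

Lemma gexp_sumM (s1 s2 : R) L1 L2 : exists L, forall t,
  gexp_sum s1 L1 t * gexp_sum s2 L2 t = gexp_sum (s1 + s2) L t.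
Proof.
exists [seq ([tuple tnth v.1 i + tnth w.1 i | i < m], v.2 + w.2) | v <- L1, w <- L2].
move=> t; rewrite /gexp_sum big_allpairs_dep mulr_suml; apply: eq_bigr => v _.
rewrite mulr_sumr; apply: eq_bigr => w _.
rewrite /gexp -expRD; congr expR => /=.
rewrite (_ : dot [tuple _ | _ < _] _ = dot v.1 (X t) + dot w.1 (X t)); first by ring.
by rewrite /dot -big_split; apply: eq_bigr => i _; rewrite tnth_mktuple mulrDl.
Qed.

Lemma gexp_sumX (s : R) L k : exists L', forall t,
  gexp_sum s L t ^+ k.+1 = gexp_sum (k.+1%:R * s) L' t.
Proof.
elim: k => [|k [L' IH]]; first by exists L => t; rewrite expr1 mul1r.
have [L'' E] := gexp_sumM s (k.+1%:R * s) L L'; exists L'' => t.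
suff -> : k.+2%:R * s = s + k.+1%:R * s by rewrite exprS IH E.
by rewrite -[k.+2]addn1 natrD mulrDl mul1r addrC.
Qed.

Lemma bounded_gexp_sum s L : 0 < s -> bounded_mfun (gexp_sum s L).
Proof. by move=> s0; apply: bounded_mfun_sum => w; exact: bounded_gexp. Qed.

Lemma gap_gexp_sum s L : 0 < s -> gap (gexp_sum s L) = 0.
Proof.
move=> s0; rewrite /gexp_sum gap_sum//; last by move=> w; exact: bounded_gexp.
by apply: big1 => w _; exact: gap_gexp.
Qed.

Lemma gap_gexp_sumX s L k : 0 < s -> gap (fun t => gexp_sum s L t ^+ k) = 0.
Proof.
move=> s0; case: k => [|k].
  (* The zeroth power is the constant 1, where equality of the masses of [Theta] is used; positive
     powers are again Gaussian sums. *)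
  rewrite (@eq_gap _ _ _ _ _ _ _ (fun=> 1)); last by move=> t _; rewrite expr0.
  exact: gap_cst.
have [L' E] := gexp_sumX s L k.
rewrite (@eq_gap _ _ _ _ _ _ _ (gexp_sum (k.+1%:R * s) L')); last by move=> t _.
by rewrite gap_gexp_sum// mulr_gt0.
Qed.

(** The power series of the exponential is applied to a function bounded by some [M]: every power
    has zero gap, and [exp M] dominates the partial sums. *)
Lemma gap_exp_gexp_sum s L : 0 < s -> gap (fun t => expR (- gexp_sum s L t)) = 0.
Proof.
move=> s0; have [mv [M vM]] := bounded_gexp_sum L s0.
have bX k c : bounded_mfun (fun t => c * gexp_sum s L t ^+ k).
  apply: bounded_mfunZ; elim: k => [|k IH].
    by under eq_fun do rewrite expr0; exact: bounded_mfun_cst.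
  by under eq_fun do rewrite exprS; apply: bounded_mfunM => //; exact: bounded_gexp_sum.
have E n t : exp_psum n (- gexp_sum s L t) =
    \sum_(k < n) ((-1) ^+ k / k`!%:R) * gexp_sum s L t ^+ k.
  by apply: eq_bigr => k _; rewrite (exprNn (gexp_sum s L t)) mulrAC.
have : gap (fun t => exp_psum n (- gexp_sum s L t)) @[n --> \oo] -->
    gap (fun t => expR (- gexp_sum s L t)).
  apply: (@gap_cvg _ _ _ _ mTheta _ _ _ _ (expR M)).
  - move=> n; under eq_fun do rewrite E.
    by apply: measurable_sum => k; have [] := bX k ((-1) ^+ k / k`!%:R).
  - move=> n t Tt; rewrite (le_trans (exp_psum_norm _ _))// ler_expR normrN.
    exact: vM.
  - by move=> t _; exact: cvg_exp_psum.
rewrite (_ : (fun n => _) = fun=> 0).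
  by move=> /(cvg_lim (@Rhausdorff R)) <-; rewrite lim_cst.
apply/funext => n; under [X in gap X]eq_fun do rewrite E.
rewrite gap_sum// big1// => k _; rewrite gapZ// ?gap_gexp_sumX ?mulr0//.
by have := bX k 1; under eq_fun do rewrite mul1r.
Qed.

(* With N = n + 1, the exponent - |x|^2 / N + N^2 (x_i - c) - N tends to -oo
   if x_i <= c and to +oo otherwise; the term - N settles the case x_i = c. *)
Lemma gap_orthant (s : seq ('I_m * R)) :
  gap (fun t => \1_(orthant s) (X t)) = 0.
Proof.
pose w n (ic : 'I_m * R) : m.-tuple R * R :=
  ([tuple if i == ic.1 then n.+1%:R ^+ 2 else 0 | i < m],
   - (n.+1%:R ^+ 2 * ic.2 + n.+1%:R)).
pose v n := gexp_sum n.+1%:R^-1 (map (w n) s).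
have vE n t : v n t = \sum_(ic <- s) expR (- (n.+1%:R^-1 * dot (X t) (X t)) +
    n.+1%:R ^+ 2 * (tnth (X t) ic.1 - ic.2) - n.+1%:R).
  rewrite /v /gexp_sum big_map; apply: eq_bigr => ic _; rewrite /gexp; congr expR.
  rewrite (_ : dot (w n ic).1 _ = n.+1%:R ^+ 2 * tnth (X t) ic.1)/=; first by ring.
  rewrite /dot (bigD1 ic.1)//= big1 ?addr0; first by rewrite tnth_mktuple eqxx.
  by move=> i /negbTE ine; rewrite tnth_mktuple ine mul0r.
have v0 n t : 0 <= v n t by apply: sumr_ge0 => ? _; exact: expR_ge0.
have N0 n : 0 < n.+1%:R^-1 :> R by rewrite invr_gt0.
have mv n : measurable_fun Theta (v n).
  by have [] := bounded_gexp_sum (map (w n) s) (N0 n).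
have expN0 : expR (- n.+1%:R) @[n --> \oo] --> (0 : R).
  by rewrite (cvg_shiftS (fun n => expR (- n%:R))); exact: cvgn_expR.
suff vcvg t : expR (- v n t) @[n --> \oo] --> (\1_(orthant s) (X t) : R).
  have : gap (fun t => expR (- v n t)) @[n --> \oo] -->
      gap (fun t => \1_(orthant s) (X t)).
    apply: (@gap_cvg _ _ _ _ mTheta _ _ _ _ 1).
    - by move=> n; apply: measurableT_comp => //; exact: measurableT_comp.
    - by move=> n t _; rewrite ger0_norm ?expR_ge0// expR_le1 oppr_le0.
    - by move=> t _; exact: vcvg.
  rewrite (_ : (fun n => _) = fun=> 0).
    by move=> /(cvg_lim (@Rhausdorff R)) <-; rewrite lim_cst.
  by apply/funext => n; exact: gap_exp_gexp_sum.
(* Inside the orthant each summand is at most [exp (- N)], so [v n t] tends to 0; outside, one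
   violated constraint alone sends [v n t] to infinity. *)
rewrite indicE; have [/set_mem st|/negP st] := boolP (X t \in orthant s).
  have vle n : v n t <= (size s)%:R * expR (- n.+1%:R).
    rewrite vE; elim: s st {w v vE v0 mv} => [|ic s IH]/=.
      by rewrite big_nil mul0r.
    move=> /andP[tic /IH]; rewrite big_cons -[(size s).+1]addn1 natrD mulrDl mul1r addrC => h.
    rewrite lerD// ler_expR.
    have : 0 <= n.+1%:R^-1 * dot (X t) (X t) by rewrite mulr_ge0 ?dot_ge0// ltW.
    have : n.+1%:R ^+ 2 * (tnth (X t) ic.1 - ic.2) <= 0.
      by rewrite mulr_ge0_le0 ?exprn_ge0// subr_le0.
    by move: (_^-1 * _) (_ ^+ 2 * _) => A B ? ?; lra.
  apply: (@squeeze_cvgr _ _ _ _ (fun n => 1 - (size s)%:R * expR (- n.+1%:R)) (fun=> 1)).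
  - apply: nearW => n; rewrite expR_le1 oppr_le0 v0 andbT.
    by rewrite (le_trans _ (expR_ge1Dx _))// lerD2l lerN2.
  - rewrite -[X in _ --> X]subr0 -[X in _ - X](mulr0 (size s)%:R).
    by apply: cvgB; [exact: cvg_cst|apply: cvgM => //; exact: cvg_cst].
  - exact: cvg_cst.
have {st} /allPn[[i c] sic /=] : ~~ all (fun ic => tnth (X t) ic.1 <= ic.2) s.
  by apply/negP => st'; apply: st; rewrite inE.
rewrite -ltNge -subr_gt0; set e := tnth (X t) i - c => e0.
set D := dot (X t) (X t); have D0 : 0 <= D by exact: dot_ge0.
apply: (@squeeze_cvgr _ _ _ _ (fun=> 0) (fun n => expR D * expR (- n.+1%:R))).
- near=> n; rewrite expR_ge0/=.
  rewrite -expRD ler_expR lerNl vE (big_rem (i, c))//= -/e -/D.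
  apply: (@le_trans _ _ (expR (- (n.+1%:R^-1 * D) + n.+1%:R ^+ 2 * e - n.+1%:R))).
    apply: le_trans (expR_ge1Dx _).
    (* From this rank on [N^2 * e] is at least [2 * N], so the exponent is at least [N - D], and
       [1 + x <= exp x] bounds [v n t] below by [N - D]. *)
    have Ne : 2 / e <= n.+1%:R.
      by rewrite (@le_trans _ _ n%:R) ?ler_nat//; near: n; exact: nbhs_infty_ger.
    rewrite ler_pdivrMr// in Ne.
    have N1 : 1 <= n.+1%:R :> R by rewrite ler1n.
    have ND : n.+1%:R^-1 * D <= D by rewrite ler_piMl// invf_le1.
    have := ler_wpM2l (le_trans ler01 N1) Ne.
    rewrite expr2 -mulrA; move: ND N1 D0.
    move: (n.+1%:R^-1 * D) => A; move: (n.+1%:R * (n.+1%:R * e)) => B.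
    by move: (n.+1%:R) => N *; lra.
  by rewrite lerDl sumr_ge0// => ? _; exact: expR_ge0.
- exact: cvg_cst.
- by rewrite -[X in _ --> X](mulr0 (expR D)); apply: cvgM => //; exact: cvg_cst.
Unshelve. all: by end_near. Qed.

End gaussian_separation.

(** * Inner regularity on the space of tuples *)

Section regularity.
Context (R : realType) (n : nat).

(** Row vectors carry the topology and tuples the sigma-algebra; preimages under this map pass from
    one to the other. *)
Definition to_row (t : n.-tuple R) : 'rV[R]_n := \row_i tnth t i.

(** An open set is the countable union of the sup-norm balls it contains that have rational centre
    and radius [1 / (k + 1)], and such a ball is a finite intersection of coordinate strips. *)
Lemma measurable_open_row (O : set 'rV[R]_n) : open O -> measurable (to_row @^-1` O).
Proof.
move=> oO.
pose rball (wk : 'rV[rat]_n * nat) : set 'rV[R]_n :=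
  ball (map_mx ratr wk.1 : 'rV[R]_n) wk.2.+1%:R^-1.
have -> : to_row @^-1` O =
    \bigcup_wk (if `[< rball wk `<=` O >] then to_row @^-1` rball wk else set0).
  apply/seteqP; split => [t|t [wk _]]; last first.
    by case: ifPn => // /asboolP h; exact: h.
  move=> Ot; have /nbhs_ballP[e/= e0 teO] : nbhs (to_row t) O by exact: open_nbhs_nbhs.
  (* With radius below [e / 2], a ball whose rational centre is within that radius of the point
     stays inside the [e]-ball. *)
  have [k _ /(_ k (leqnn k)) ke] := near_infty_natSinv_lt (PosNum (divr_gt0 e0 (ltr0n R 2))).
  have k0 : 0 < k.+1%:R^-1 :> R by rewrite invr_gt0.
  have rq (i : 'I_n) : exists q : rat, `|tnth t i - ratr q| < k.+1%:R^-1.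
    move: (k.+1%:R^-1) k0 => r r0.
    have : tnth t i - r < tnth t i + r by lra.
    move=> /rat_in_itvoo[q]; rewrite in_itv/= => /andP[q1 q2]; exists q.
    by rewrite ltr_norml; apply/andP; split; lra.
  have [w wP] := choice rq.
  exists (\row_i w i, k) => //; rewrite asboolT.
    split; first by [].
    by move=> i j; rewrite !mxE /ball/= distrC.
  move=> v [_ vw]; apply: teO; split => // i j.
  have := ler_normD (tnth t j - ratr (w j)) (ratr (w j) - v ord0 j).
  rewrite addrA subrK; have := vw i j; rewrite ord1 /ball/= !mxE.
  have := wP j; rewrite /= in ke; move: (k.+1%:R^-1) ke => r.
  by move=> *; lra.
apply: countable_bigcupT_measurable; first exact: countableP.
move=> wk; case: ifPn => // _.
rewrite (_ : _ @^-1` _ = \bigcap_(i in [set: 'I_n])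
    [set t | `|ratr (wk.1 ord0 i) - tnth t i| < wk.2.+1%:R^-1]).
  apply: fin_bigcap_measurable => // i _.
  rewrite -[X in measurable X]setTI.
  apply: (measurable_fun_ltr (f := fun t : n.-tuple R => `|ratr (wk.1 ord0 i) - tnth t i|)
     (g := fun=> wk.2.+1%:R^-1)) => //.
  apply: measurableT_comp => //; apply: measurable_funB => //.
  exact: measurable_tnth.
apply/seteqP; split => t /=.
  by move=> [_ h] i _; have := h ord0 i; rewrite /ball/= !mxE.
move=> h; split => [|i j]; first by rewrite invr_gt0.
by rewrite !mxE ord1; exact: h.
Qed.

Lemma measurable_closed_row (C : set 'rV[R]_n) : closed C -> measurable (to_row @^-1` C).
Proof.
move=> cC; rewrite -[C]setCK preimage_setC; apply: measurableC.
by apply: (@measurable_open_row (~` C)); rewrite openC.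
Qed.

Local Open Scope ereal_scope.
Variable mu : {measure set (n.-tuple R) -> \bar R}.
Hypothesis mu_fin : mu setT < +oo.

Lemma setD_bigcup_lt (A : set (n.-tuple R)) (G : nat -> set (n.-tuple R)) e :
  measurable A -> (forall k, measurable (G k)) -> nondecreasing_seq G ->
  mu (A `\` \bigcup_k G k) < e -> exists k, mu (A `\` G k) < e.
Proof.
move=> mA mG ndG mue; apply: contrapT => /forallNP h; move: mue; apply/negP.
rewrite -leNgt.
have cG : mu (A `\` G k) @[k --> \oo] --> mu (A `\` \bigcup_k G k).
  have E : A `\` \bigcup_k G k = \bigcap_k (A `\` G k).
    by rewrite setDE setC_bigcup -bigcapIr//; exists 0%N.
  rewrite E; apply: (nonincreasing_cvg_mu (F := fun k => A `\` G k)).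
  - by rewrite (le_lt_trans _ mu_fin)// le_measure// ?inE//; exact: measurableD.
  - by move=> k; exact: measurableD.
  - by apply: bigcapT_measurable => k; exact: measurableD.
  - by move=> i j ij; apply/subsetPset; apply: setDS; apply/subsetPset/ndG.
rewrite -(cvg_lim _ cG)//; apply: lime_ge; first by apply/cvg_ex; eexists; exact: cG.
by apply: nearW => k; rewrite leNgt; apply/negP; exact: h.
Qed.

(** Approximation from both sides makes the class stable under complement: the closed and the open
    set exchange roles. *)
Let regular (A : set (n.-tuple R)) : Prop := forall e : R, (0 < e)%R ->
  exists C U : set 'rV[R]_n, [/\ closed C, open U, to_row @^-1` C `<=` A,
    A `<=` to_row @^-1` U & mu (to_row @^-1` U `\` to_row @^-1` C) < e%:E].

Let regular_sigma_algebra : sigma_algebra setT regular.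
Proof.
split.
- move=> e e0; exists set0, set0; split; [exact: closed0|exact: open0|by []|by []|].
  by rewrite preimage_set0 setD0 measure0 lte_fin.
- move=> A rA e /rA[C [U [cC oU CA AU CU]]].
  exists (~` U), (~` C); split; [by rewrite closedC|by rewrite openC| | |].
  + by move=> t Ut; split => // /AU.
  + by move=> t [_ At] /CA.
  + move: CU; congr (mu _ < _); apply/seteqP; split => t /=; first by move=> [? ?]; split.
    by move=> [? /contrapT].
- move=> F rF e e0.
  (* The errors then sum to at most [e / 2], strictly below [e]. *)
  have e20 : (0 < e / 2)%R by rewrite divr_gt0.
  have /choice[CU CUP] : forall k, exists CU : set 'rV[R]_n * set 'rV[R]_n,
     [/\ closed CU.1, open CU.2, to_row @^-1` CU.1 `<=` F k,
    F k `<=` to_row @^-1` CU.2 & mu (to_row @^-1` CU.2 `\` to_row @^-1` CU.1)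
      < (e / 2 / (2 ^ k.+1)%:R)%:E].
    move=> k; have /(rF k)[C [U h]] : (0 < e / 2 / (2 ^ k.+1)%:R)%R.
      by rewrite divr_gt0// ltr0n expn_gt0.
    by exists (C, U).
  pose U := \bigcup_k (CU k).2.
  have oU : open U by rewrite /U; apply: bigcup_open => k _; have [_ + _ _ _] := CUP k.
  (* The union of all the closed sets need not be closed; a finite one is, and continuity from above
     shows that some [N] is large enough. *)
  pose C N := \bigcup_(k < N) (CU k).1.
  have cC N : closed (C N).
    by apply: closed_bigcup => [|k _]; [exact: finite_II|have [cl _ _ _ _] := CUP k].
  have mC1 k : measurable (to_row @^-1` (CU k).1).
    have [cl _ _ _ _] := CUP k; exact: measurable_closed_row cl.
  have mU1 k : measurable (to_row @^-1` (CU k).2).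
    have [_ op _ _ _] := CUP k; exact: measurable_open_row op.
  have [||||N muN] := @setD_bigcup_lt (to_row @^-1` U) (fun N => to_row @^-1` C N) e%:E.
  + exact: measurable_open_row.
  + by move=> k; exact: measurable_closed_row.
  + move=> i j ij; apply/subsetPset => t [k /= ki kt]; exists k => //=.
    exact: leq_trans ki ij.
  + apply: (@le_lt_trans _ _ (\sum_(k <oo) (e / 2 / (2 ^ k.+1)%:R)%:E)); last first.
      rewrite (le_lt_trans (epsilon_trick0 _ _))// ?(ltW e20)//.
      by rewrite lte_fin ltr_pdivrMr// ltr_pMr// ltr1n.
    apply: (@le_trans _ _ (\sum_(k <oo) mu (to_row @^-1` (CU k).2 `\` to_row @^-1` (CU k).1))).
      apply: measure_sigma_subadditive.
      * by move=> k; exact: measurableD.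
      * apply: measurableD; first exact: measurable_open_row.
        by apply: bigcupT_measurable => k; exact: measurable_closed_row.
      * move=> t [[k _ kt] nt]; exists k => //; split => // Ct.
        by apply: nt; exists k.+1 => //; exists k => //=.
    by apply: lee_nneseries => // k _; have [_ _ _ _ /ltW] := CUP k.
  exists (C N), U; split => //.
  + by move=> t [k _ kt]; exists k => //; have [_ _ h _ _] := CUP k; exact: h.
  + by move=> t [k _ kt]; exists k => //; have [_ _ _ h _] := CUP k; exact: h.
Qed.

Lemma closed_regular A : measurable A -> regular A.
Proof.
apply: (measurable_tuple_ind regular_sigma_algebra) => i c e e0.
have mC k : measurable [set t : n.-tuple R | (c + k.+1%:R^-1 <= tnth t i)%R].
  rewrite -[X in measurable X]setTI.
  by apply: measurable_fun_ler => //; exact: measurable_tnth.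
have cont : continuous (fun v : 'rV[R]_n => v ord0 i) by exact: coord_continuous.
have clC : closed [set v : 'rV[R]_n | (v ord0 i <= c)%R].
  exact: (closed_comp (f := fun v : 'rV[R]_n => v ord0 i) (fun v _ => cont v) (@closed_le R c)).
(* The half-space is its own closed approximation, and the open one exceeds it by the strip
   [c < t_i < c + 1 / (k + 1)]. The complements of these strips increase to the whole space. *)
have [||||k muk] := @setD_bigcup_lt setT (fun k => [set t : n.-tuple R | (tnth t i <= c)%R]
   `|` [set t : n.-tuple R | (c + k.+1%:R^-1 <= tnth t i)%R]) e%:E => //.
- move=> k; apply: measurableU => //; rewrite -[X in measurable X]setTI.
  by apply: measurable_fun_ler => //; exact: measurable_tnth.
- move=> j k jk; apply/subsetPset => t [|h]; [by left|right].
  by rewrite /= (le_trans _ h)// lerD2l lef_pV2 ?posrE// ler_nat.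
- rewrite (_ : _ `\` _ = set0) ?measure0//; apply/seteqP; split => // t [_ h].
  apply: h; have [tc|ct] := leP (tnth t i) c; first by exists 0%N => //; left.
  have ct0 : (0 < tnth t i - c)%R by rewrite subr_gt0.
  have [k _ /(_ k (leqnn k)) ke] := near_infty_natSinv_lt (PosNum ct0).
  by exists k => //; right; rewrite /= -lerBrDl ltW.
exists [set v : 'rV[R]_n | (v ord0 i <= c)%R], [set v : 'rV[R]_n | (v ord0 i < c + k.+1%:R^-1)%R].
split => //.
- apply: (open_comp (f := fun v : 'rV[R]_n => v ord0 i) _ (@open_lt R (c + k.+1%:R^-1)%R)).
  by move=> v _; exact: cont.
- by move=> t /=; rewrite mxE.
- by move=> t /=; rewrite mxE => /le_lt_trans; apply; rewrite ltrDl invr_gt0.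
- move: muk; congr (mu _ < _); apply/seteqP; split => t; rewrite /= !mxE.
    move=> [_ /not_orP[h1 /negP h2]]; split=> //; by rewrite ltNge.
  by move=> [h1 h2]; split => // -[//|]; rewrite leNgt h1.
Qed.

Lemma compact_regular A (e : R) : measurable A -> (0 < e)%R ->
  exists C : set 'rV[R]_n, [/\ compact C, to_row @^-1` C `<=` A &
    mu (A `\` to_row @^-1` C) < e%:E].
Proof.
move=> mA e0; have [C [U [cC oU CA AU muUC]]] := closed_regular mA e0.
(* Cutting the closed set by growing cubes makes it compact at a vanishing cost in mass. *)
pose K (N : nat) := [set v : 'rV[R]_n | forall i, (`[(- N%:R)%R, (N%:R)%R]%classic : set R) (v ord0 i)].
have cK N : compact (K N).
  have := @rV_compact R n (fun=> `[(- N%:R)%R, (N%:R)%R]%classic).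
  by apply=> _; exact: segment_compact.
have cKC N : compact (K N `&` C) by exact: compact_closedI.
have clKC N : closed (K N `&` C).
  by apply: compact_closed => //; exact: norm_hausdorff.
have [||||N muN] := @setD_bigcup_lt A (fun N => to_row @^-1` (K N `&` C)) e%:E => //.
- by move=> k; exact: measurable_closed_row.
- move=> i j ij; apply/subsetPset => t [tK tC]; split => // l.
  have := tK l; rewrite /= !in_itv/= => /andP[h1 h2].
  have ij' : (i%:R <= j%:R :> R)%R by rewrite ler_nat.
  by apply/andP; split; lra.
- apply: le_lt_trans muUC; apply: le_measure; rewrite ?inE.
  + apply: measurableD => //; apply: bigcupT_measurable => k; exact: measurable_closed_row.
  + apply: measurableD; [exact: measurable_open_row|exact: measurable_closed_row].
  + move=> t [At nt]; split; first exact: AU.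
    move=> Ct; apply: nt; pose M := (\sum_(i < n) `|tnth t i|)%R.
    exists (Num.truncn M).+1 => //; split => // i.
    have M0 : (0 <= M)%R by exact: sumr_ge0.
    have : (`|tnth t i| <= (Num.truncn M).+1%:R)%R.
      apply: (@le_trans _ _ M); last exact/ltW/truncnS_gt.
      by rewrite /M (bigD1 i)//= lerDl sumr_ge0.
    by rewrite ler_norml /= mxE in_itv.
by exists (K N `&` C); split => // t [_ /CA].
Qed.

End regularity.

(** * Borel sets as preimages under an injective map *)

Section injective_embedding.
Context (R : realType) (D m : nat).
Variables (Theta : set (D.-tuple R)) (phi : D.-tuple R -> m.-tuple R).
Hypothesis mTheta : measurable Theta.
Hypothesis mphi : measurable_fun Theta phi.
Hypothesis phi_inj : forall x y, Theta x -> Theta y -> phi x = phi y -> x = y.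

(** A default value outside [Theta] makes the coordinates of [phi], and so the graph map, measurable
    on the whole space. *)
Let phi0 (j : 'I_m) : D.-tuple R -> R := (fun t => tnth (phi t) j) \_ Theta.

Let mphi0 j : measurable_fun setT (phi0 j).
Proof.
apply/(measurable_restrictT _ mTheta).
exact: (measurableT_comp (measurable_tnth j) mphi).
Qed.

Let graph (t : D.-tuple R) : (D + m).-tuple R :=
  [tuple match fintype.split k with inl i => tnth t i | inr j => phi0 j t end | k < D + m].

Let base (z : (D + m).-tuple R) : D.-tuple R := [tuple tnth z (lshift m i) | i < D].

Let mgraph : measurable_fun setT graph.
Proof.
apply/measurable_fun_tnthP => k.
rewrite (_ : _ \o _ = fun t => match fintype.split k with inl i => tnth t i | inr j => phi0 j t end).
  by case: (fintype.split k) => [i|j]; [exact: measurable_tnth|exact: mphi0].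
by apply/funext => t; rewrite /= tnth_mktuple.
Qed.

Let mbase : measurable_fun setT base.
Proof.
apply/measurable_fun_tnthP => i; rewrite (_ : _ \o _ = fun z => tnth z (lshift m i)).
  exact: measurable_tnth.
by apply/funext => t; rewrite /= tnth_mktuple.
Qed.

Let graphK t : base (graph t) = t.
Proof.
apply: eq_from_tnth => i; rewrite !tnth_mktuple.
by rewrite (unsplitK (inl i : 'I_D + 'I_m)).
Qed.

(** [base] is a measurable left inverse of [graph], so the image consists of the points over [A]
    fixed by [graph \o base]. *)
Let measurable_graph A : measurable A -> measurable (graph @` A).
Proof.
move=> mA; rewrite (_ : graph @` A = base @^-1` A `&`
    \bigcap_(k in [set: 'I_(D + m)]) [set z | tnth (graph (base z)) k = tnth z k]).
  apply: measurableI; first by rewrite -[X in measurable X]setTI; exact: mbase.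
  apply: fin_bigcap_measurable => // k _.
  have mk : measurable_fun setT (fun z => tnth (graph (base z)) k - tnth z k).
    apply: measurable_funB; last exact: measurable_tnth.
    apply: (measurableT_comp (measurable_tnth k)).
    exact: (measurableT_comp mgraph mbase).
  have := mk measurableT _ (measurable_set1 0); rewrite setTI.
  congr measurable; apply/seteqP; split => z /=.
    by move/eqP; rewrite subr_eq0 => /eqP.
  by move=> ->; rewrite subrr.
apply/seteqP; split => [_ [t At <-]|z [Az zE]].
  by split; rewrite /= ?graphK// => k _; rewrite /= graphK.
exists (base z) => //; apply: eq_from_tnth => k; exact: (zE k).
Qed.

Lemma rsubmx_continuous : continuous (rsubmx : 'rV[R]_(D + m) -> 'rV[R]_m).
Proof.
move=> v A /= /nbhs_ballP[e/= e0 eA].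
apply/nbhs_ballP; exists e => // w [_ vw]; apply: eA; split=> // i j.
by rewrite !mxE; exact: vw.
Qed.

(* A compact set of the graph over [A] projects to a compact, hence Borel, set
   of the target; by injectivity its preimage stays inside [A]. *)
Lemma phi_preimage_inner (mu : probability (D.-tuple R) R) (A : set (D.-tuple R)) (e : R) :
  measurable A -> A `<=` Theta -> 0 < e ->
  exists B : set (m.-tuple R), [/\ measurable B, Theta `&` phi @^-1` B `<=` A &
    (mu (A `\` (Theta `&` phi @^-1` B)) < e%:E)%E].
Proof.
move=> mA ATheta e0.
pose nu : {measure set ((D + m).-tuple R) -> \bar R} :=
  distribution mu (mfun_Sub (mem_set mgraph : graph \in mfun)).
have nuE B : nu B = mu (graph @^-1` B) by [].
have nu_fin : (nu setT < +oo)%E by rewrite nuE preimage_setT probability_setT ltry.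
have [C [cC CA nuC]] := compact_regular nu_fin (measurable_graph mA) e0.
have clB : closed (rsubmx @` C).
  apply: compact_closed; first exact: norm_hausdorff.
  apply: continuous_compact => //; apply: continuous_subspaceT.
  exact: rsubmx_continuous.
have row_phi t : Theta t -> to_row (phi t) = rsubmx (to_row (graph t)).
  move=> Tt; apply/rowP => j; rewrite !mxE tnth_mktuple.
  by rewrite (unsplitK (inr j : 'I_D + 'I_m)) /phi0 patchT// inE.
have graphC t : C (to_row (graph t)) -> A t.
  by move=> /CA[s As] /(congr1 base); rewrite !graphK => <-.
(* Injectivity enters here: a point of [Theta] with the same image under [phi] as some [s] in [A]
   must be [s]. *)
have preimE : Theta `&` phi @^-1` (@to_row R m @^-1` (rsubmx @` C)) =
    graph @^-1` (@to_row R (D + m) @^-1` C).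
  apply/seteqP; split => [t [Tt [c Cc]]|t Ct].
    rewrite row_phi// => cE.
    have [z zE] : exists z, c = to_row z.
      by exists [tuple c ord0 i | i < D + m]; apply/rowP => i; rewrite mxE tnth_mktuple.
    move: Cc cE; rewrite zE => Cz; have [s As sz] := CA _ Cz; rewrite -sz.
    move=> /rowP h; rewrite (_ : t = s); first by rewrite /= sz.
    apply: phi_inj => //; first exact: ATheta.
    apply: eq_from_tnth => j; have := h j.
    by rewrite -!row_phi ?mxE//; exact: ATheta.
  have Tt := ATheta _ (graphC _ Ct); split=> //.
  by exists (to_row (graph t)) => //; rewrite row_phi.
exists (@to_row R m @^-1` (rsubmx @` C)); split.
- exact: measurable_closed_row.
- by rewrite preimE => t; exact: graphC.
- rewrite preimE; move: nuC; rewrite nuE; congr (mu _ < _)%E.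
  apply/seteqP; split => [t [[s As /(congr1 base)]]|t [At nCt]].
    by rewrite !graphK => <-.
  by split=> //; exists t.
Qed.

(** The assumption is symmetric, so one inequality suffices: up to [e], the mass of [A] under the
    first measure sits on a preimage inside [A], which has the same mass under the second. *)
Lemma phi_preimage_unique (p q : probability (D.-tuple R) R) :
  (forall B, measurable B -> p (Theta `&` phi @^-1` B) = q (Theta `&` phi @^-1` B)) ->
  forall A, measurable A -> A `<=` Theta -> p A = q A.
Proof.
move=> pq A mA AT.
suff le (p' q' : probability (D.-tuple R) R) :
    (forall B, measurable B -> p' (Theta `&` phi @^-1` B) = q' (Theta `&` phi @^-1` B)) ->
    (p' A <= q' A)%E.
  apply/eqP; rewrite eq_le !le//.
  by move=> B mB; rewrite pq.
move=> pq'; apply/lee_addgt0Pr => e e0.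
have [B [mB BA Be]] := phi_preimage_inner p' mA AT e0.
have mTB : measurable (Theta `&` phi @^-1` B) by exact: mphi.
have le1 : (p' (Theta `&` phi @^-1` B) <= q' A)%E by rewrite pq'// le_measure ?inE.
rewrite -[in leLHS](setDUK BA) (le_trans (measureU2 _ _ _))//; first exact: measurableD.
exact: leeD le1 (ltW Be).
Qed.

End injective_embedding.

(** * The probability integral transform *)

Section law.
Local Open Scope ereal_scope.
Context d d' (T : measurableType d) (T' : measurableType d') (R : realType).
Variables (Theta : set T) (mTheta : measurable Theta).

Lemma probability_carrierI (p : probability T R) A :
  p Theta = 1 -> measurable A -> p (Theta `&` A) = p A.
Proof.
move=> pT mA; rewrite -[in RHS](setUIDK A Theta) measureU//.
- rewrite [X in _ + X](_ : _ = 0) ?adde0 1?setIC//.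
  apply/eqP; rewrite eq_le measure_ge0 andbT.
  rewrite -(_ : p (~` Theta) = 0); last by rewrite probability_setC// pT subee.
  by apply: le_measure; rewrite ?inE; [exact: measurableD|exact: measurableC|move=> t []].
- exact: measurableI.
- exact: measurableD.
- by rewrite setDE setIACA setICr setI0.
Qed.

(** The law is the push-forward by [f] extended by a default value, which is taken only on the null
    complement of [Theta]. *)
Lemma probability_law (p : probability T R) (f : T -> T') :
  p Theta = 1 -> measurable_fun Theta f ->
  exists nu : probability T' R,
    (forall B, measurable B -> nu B = p (Theta `&` f @^-1` B)) /\
    (forall h : T' -> \bar R, measurable_fun setT h -> (forall y, 0 <= h y) ->
      \int[p]_(x in Theta) h (f x) = \int[nu]_y h y).
Proof.
move=> pT mf; have mf0 := (measurable_restrictT f mTheta).1 mf.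
have f0E t : Theta t -> (f \_ Theta) t = f t by move=> Tt; rewrite patchT// inE.
have pC0 : p (~` Theta) = 0 by rewrite probability_setC// pT subee.
exists (distribution p (mfun_Sub (mem_set mf0 : (f \_ Theta) \in mfun))); split.
- move=> B mB.
  have mf0B : measurable ((f \_ Theta) @^-1` B).
    by rewrite -[X in measurable X]setTI; exact: (mf0 measurableT B mB).
  rewrite -[LHS](probability_carrierI pT mf0B).
  by congr (p _); apply/seteqP; split => t [Tt]; rewrite /= f0E.
- move=> h mh h0; rewrite ge0_integral_distribution//.
  rewrite [RHS](ge0_negligible_integral (N := ~` Theta))//.
  + by rewrite setDE setTI setCK; apply: eq_integral => t /set_mem Tt /=; rewrite f0E.
  + exact: measurableC.
  + exact: measurableT_comp.
  + by move=> x _; exact: h0.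
Qed.

End law.

Section real_laws.
Local Open Scope ereal_scope.
Context (R : realType).

Lemma finite_measure_unique_ray (m1 m2 : {measure set R -> \bar R}) :
  m1 setT < +oo -> (forall r, m1 `]-oo, r]%classic = m2 `]-oo, r]%classic) ->
  forall A, measurable A -> m1 A = m2 A.
Proof.
move=> m1oo m12 A mA.
pose G : set (set R) := range (fun r => `]-oo, r]%classic).
apply: (measure_unique G (fun n => `]-oo, n%:R]%classic)) => //.
- rewrite -[LHS]/((@ocitv R).-sigma.-measurable) RGenOInfty.measurableE.
  apply/seteqP; split; apply: smallest_sub; try exact: smallest_sigma_algebra.
    move=> _ [x ->]; rewrite -setCitvl -setTD.
    have [_ GC _] := smallest_sigma_algebra setT G; apply: GC.
    by apply: sub_sigma_algebra; exists x.
  move=> _ [x _ <-]; rewrite -setCitvr -setTD.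
  have [_ GC _] := smallest_sigma_algebra setT (@RGenOInfty.G R); apply: GC.
  by apply: sub_sigma_algebra; exists x.
- move=> _ _ [x _ <-] [y _ <-]; exists (Num.min x y) => //.
  by apply/seteqP; split => t /=; rewrite !in_itv/= le_min => /andP.
- by move=> n; exists n%:R.
- apply/seteqP; split => // x _; exists (Num.truncn x).+1 => //=.
  by rewrite in_itv/= ltW// truncnS_gt.
- by move=> _ [x _ <-].
- by move=> k; rewrite (le_lt_trans _ m1oo)// le_measure// ?inE.
Qed.

Lemma uniform01_ray (u : R) : (0 <= u <= 1)%R ->
  uniform_prob (@ltr01 R) `]-oo, u]%classic = u%:E.
Proof.
move=> /andP[u0 u1]; rewrite /uniform_prob integral_uniform_pdf.
rewrite (_ : _ `&` _ = `[0%R, u]%classic); last first.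
  apply/seteqP; split => x /=; rewrite !in_itv/=.
    by move=> [xu /andP[-> _]].
  by move=> /andP[x0 xu]; rewrite xu x0 (le_trans xu).
rewrite (eq_integral (fun=> 1)); last first.
  move=> x; rewrite inE/= in_itv/= => /andP[x0 xu].
  by rewrite /uniform_pdf x0 (le_trans xu)//= subr0 invr1.
rewrite integral_cst//= mul1e lebesgue_measure_itv/= lte_fin.
by case: ltP => [_|]; [rewrite -EFinB subr0|move=> u0'; congr EFin; lra].
Qed.

Lemma uniform01_set1 (u : R) : uniform_prob (@ltr01 R) [set u] = 0.
Proof.
have /null_content_dominatesP h := dominates_uniform_prob (@ltr01 R).
by apply: h => //; exact: lebesgue_measure_set1.
Qed.

Definition real_cdf (nu : probability R R) (r : R) : R := fine (nu `]-oo, r]%classic).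

Lemma real_cdfE (nu : probability R R) r : (real_cdf nu r)%:E = nu `]-oo, r]%classic.
Proof. by rewrite fineK// fin_num_measure. Qed.

Lemma real_cdf_bounds (nu : probability R R) r : (0 <= real_cdf nu r <= 1)%R.
Proof. by rewrite -!lee_fin real_cdfE measure_ge0 probability_le1. Qed.

Lemma real_cdf_ndecr (nu : probability R R) : {homo real_cdf nu : x y / (x <= y)%R}.
Proof.
move=> x y xy; rewrite -lee_fin !real_cdfE le_measure ?inE//.
by move=> t /=; rewrite !in_itv/= => /le_trans; apply.
Qed.

Lemma measurable_real_cdf (nu : probability R R) : measurable_fun setT (real_cdf nu).
Proof. by apply: nondecreasing_measurable => //; exact: real_cdf_ndecr. Qed.

(** With [F] the distribution function of [nu], the set [F <= F r] exceeds the ray up to [r] only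
    within the level set [F = F r]. That level set is [mu]-null because the uniform law has no atom,
    so the ray has mass [F r] under [mu]. *)
Lemma cdf_uniform_eq_ray (mu nu : probability R R) :
  (forall A, measurable A -> mu (real_cdf nu @^-1` A) = uniform_prob (@ltr01 R) A) ->
  forall r, mu `]-oo, r]%classic = nu `]-oo, r]%classic.
Proof.
move=> unif r; set F := real_cdf nu.
have mF A : measurable A -> measurable (F @^-1` A).
  by move=> mA; rewrite -[X in measurable X]setTI; exact: measurable_real_cdf.
rewrite -(real_cdfE nu) -(uniform01_ray (real_cdf_bounds nu r)) -unif//.
apply/eqP; rewrite eq_le; apply/andP; split.
  apply: le_measure; rewrite ?inE//; first exact: mF.
  by move=> x /=; rewrite !in_itv/=; exact: real_cdf_ndecr.
have F0 : mu (F @^-1` [set F r]) = 0 by rewrite unif ?uniform01_set1.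
have <- : mu (`]-oo, r]%classic `|` F @^-1` [set F r]) = mu `]-oo, r]%classic.
  by rewrite measureU0//; exact: mF.
apply: le_measure; rewrite ?inE; [exact: mF|by apply: measurableU => //; exact: mF|].
move=> x /=; rewrite !in_itv/= => Fx; have [|rx] := leP x r; first by left.
by right; apply/eqP; rewrite eq_le Fx/=; apply: real_cdf_ndecr; exact: ltW.
Qed.

Lemma measure_bigcup_le (nu : probability R R) (G : nat -> set R) a :
  (forall n, measurable (G n)) -> nondecreasing_seq G ->
  (forall n, nu (G n) <= a) -> nu (\bigcup_n G n) <= a.
Proof.
move=> mG ndG Ga.
have cG := @nondecreasing_cvg_mu _ _ _ nu _ mG (bigcupT_measurable _ mG) ndG.
rewrite -(cvg_lim _ cG)//; apply: lime_le; first by apply/cvg_ex; eexists; exact: cG.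
exact: nearW.
Qed.

Lemma measure_bigcap_ge (nu : probability R R) (G : nat -> set R) a :
  (forall n, measurable (G n)) -> nonincreasing_seq G ->
  (forall n, a <= nu (G n)) -> a <= nu (\bigcap_n G n).
Proof.
move=> mG niG Ga.
have fG : nu (G 0%N) < +oo by rewrite (le_lt_trans (probability_le1 _ _))// ltry.
have cG := @nonincreasing_cvg_mu _ _ _ nu _ fG mG (bigcapT_measurable mG) niG.
rewrite -(cvg_lim _ cG)//; apply: lime_ge; first by apply/cvg_ex; eexists; exact: cG.
exact: nearW.
Qed.

(* [F @^-1` `]-oo, u]] is a ray ending at its supremum [s]; continuity from
   below and above give [F s = u] without atoms. *)
Lemma atomless_cdf_ray (nu : probability R R) (u : R) :
  (forall r, nu [set r] = 0) -> (0 <= u < 1)%R ->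
  nu (real_cdf nu @^-1` `]-oo, u]%classic) = u%:E.
Proof.
move=> nu0 /andP[u0 u1]; set F := real_cdf nu; set S := F @^-1` _.
have SE x : S x <-> nu `]-oo, x]%classic <= u%:E by rewrite -real_cdfE lee_fin /S/= in_itv.
have Sdown x y : S y -> (x <= y)%R -> S x.
  by rewrite !SE => Sy xy; rewrite (le_trans _ Sy)// -!real_cdfE lee_fin real_cdf_ndecr.
have ubS : has_ubound S.
  apply: contrapT => nub.
  have : nu setT <= u%:E.
    rewrite (_ : setT = \bigcup_(n : nat) `]-oo, n%:R]%classic); last first.
      apply/seteqP; split => // x _; exists (Num.truncn x).+1 => //=.
      by rewrite in_itv/= ltW// truncnS_gt.
    apply: measure_bigcup_le => //.
    - move=> i j ij; apply/subsetPset => x /=; rewrite !in_itv/= => /le_trans; apply.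
      by rewrite ler_nat.
    - move=> n; apply/SE; apply: contrapT => nS; apply: nub; exists n%:R => x Sx.
      by rewrite leNgt; apply/negP => nx; apply: nS; exact: Sdown (ltW nx).
  by rewrite probability_setT lee_fin leNgt u1.
(* If [S] is empty, every ray has mass above [u]; rays shrinking to the empty set then force
   [u = 0]. *)
have [S0|] := pselect (S !=set0); last first.
  move=> /set0P/negP/negPn/eqP S0; rewrite S0 measure0.
  suff : u%:E <= nu set0.
    by rewrite measure0 lee_fin => u0'; congr EFin; apply/eqP; rewrite eq_le u0 u0'.
  rewrite (_ : set0 = \bigcap_(n : nat) `]-oo, (- n%:R)%R]%classic); last first.
    apply/seteqP; split => // x /(_ (Num.truncn (- x)).+1 I)/=.
    by rewrite in_itv/= lerNr leNgt truncnS_gt.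
  apply: measure_bigcap_ge => //.
  - move=> i j ij; apply/subsetPset => x /=; rewrite !in_itv/= => /le_trans; apply.
    by rewrite lerN2 ler_nat.
  - move=> n; rewrite leNgt; apply/negP => h.
    have : S (- n%:R)%R by apply/SE; exact: ltW.
    by rewrite S0.
set s := sup S.
have Ss : S `<=` `]-oo, s]%classic by move=> x Sx /=; rewrite in_itv/=; exact: ub_le_sup.
have sS : `]-oo, s[%classic `<=` S.
  move=> x /=; rewrite in_itv/= => xs.
  have [y Sy xy] := sup_adherent (ltac:(rewrite subr_gt0; exact: xs) : 0 < s - x)%R (conj S0 ubS).
  by apply: Sdown Sy _; rewrite -/s in xy; lra.
have openE : nu `]-oo, s[%classic = nu `]-oo, s]%classic.
  rewrite (_ : `]-oo, s]%classic = `]-oo, s[%classic `|` [set s]).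
    by rewrite measureU0//; exact: nu0.
  by apply/seteqP; split => x /=; rewrite !in_itv/= le_eqVlt;
    [move=> /predU1P[]; [right|left]|move=> [->|->]; rewrite ?eqxx ?orbT].
have mS : measurable S.
  by rewrite /S -[X in measurable X]setTI; exact: measurable_real_cdf.
have Se : nu S = nu `]-oo, s]%classic.
  apply/eqP; rewrite eq_le; apply/andP; split; first by rewrite le_measure ?inE.
  by rewrite -openE le_measure ?inE.
have invS0 n : (0 < n.+1%:R^-1 :> R)%R by rewrite invr_gt0.
have invS_le i j : (i <= j)%N -> (j.+1%:R^-1 <= i.+1%:R^-1 :> R)%R.
  by move=> ij; rewrite lef_pV2 ?posrE// ler_nat.
(* Rays ending at [s - 1 / (n + 1)] have their endpoint in [S], hence mass at most [u]; those ending
   at [s + 1 / (n + 1)] do not, hence mass above [u]. *)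
rewrite Se; apply/eqP; rewrite eq_le; apply/andP; split.
  rewrite -openE (_ : `]-oo, s[%classic = \bigcup_n `]-oo, (s - n.+1%:R^-1)%R]%classic).
    apply: measure_bigcup_le => //.
      move=> i j ij; apply/subsetPset => x /=; rewrite !in_itv/= => /le_trans; apply.
      by rewrite lerD2l lerN2 invS_le.
    by move=> n; apply/SE; apply: sS; rewrite /= in_itv/= gtrBl.
  apply/seteqP; split => x /=; rewrite ?in_itv/=.
    move=> xs; have xs0 : (0 < s - x)%R by rewrite subr_gt0.
    have [k _ /(_ k (leqnn k)) ke] := near_infty_natSinv_lt (PosNum xs0).
    by exists k => //=; rewrite in_itv/= lerBrDl addrC -lerBrDl ltW.
  by move=> [n _ /=]; rewrite in_itv/= => /le_lt_trans; apply; rewrite gtrBl.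
rewrite (_ : `]-oo, s]%classic = \bigcap_n `]-oo, (s + n.+1%:R^-1)%R]%classic).
  apply: measure_bigcap_ge => //.
    move=> i j ij; apply/subsetPset => x /=; rewrite !in_itv/= => /le_trans; apply.
    by rewrite lerD2l invS_le.
  move=> n; rewrite leNgt; apply/negP => /ltW/SE/Ss /=.
  by rewrite in_itv/= leNgt ltrDl invS0.
apply/seteqP; split => x /=.
  by rewrite in_itv/= => xs n _ /=; rewrite in_itv/= (le_trans xs)// lerDl ltW.
move=> xs; rewrite in_itv/= leNgt; apply/negP => sx.
have sx0 : (0 < x - s)%R by rewrite subr_gt0.
have [k _ /(_ k (leqnn k)) ke] := near_infty_natSinv_lt (PosNum sx0).
have := xs k I; rewrite /= in_itv/= leNgt => /negP; apply.
by rewrite -ltrBrDl.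
Qed.

Lemma probability_integral_transform (nu : probability R R) :
  (forall r, nu [set r] = 0) ->
  forall A, measurable A -> nu (real_cdf nu @^-1` A) = uniform_prob (@ltr01 R) A.
Proof.
move=> nu0.
have [law [lawE _]] := probability_law measurableT (probability_setT nu) (measurable_real_cdf nu).
suff h u : law `]-oo, u]%classic = uniform_prob (@ltr01 R) `]-oo, u]%classic.
  (* Pushing the uniform law along the identity only changes its measurable type, so that it can be
     compared with [law] on rays. *)
  have mid : measurable_fun setT (id : measurableTypeR R -> R) by exact: measurable_id.
  have [unif [unifE _]] := probability_law measurableT
    (probability_setT (uniform_prob (@ltr01 R))) mid.
  move=> A mA.
  have lawoo : (law setT < +oo) by rewrite probability_setT ltry.
  have lawu r : law `]-oo, r]%classic = unif `]-oo, r]%classic.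
    by rewrite h unifE// setTI.
  transitivity (unif A); last by rewrite unifE// setTI.
  have lawA : law A = nu (real_cdf nu @^-1` A) by rewrite lawE// setTI.
  exact: (etrans (esym lawA) (finite_measure_unique_ray lawoo lawu mA)).
rewrite lawE// setTI.
have [u0|u0] := ltP u 0%R.
  rewrite (_ : _ @^-1` _ = set0); last first.
    apply/seteqP; split => // x /=; rewrite in_itv/= => /le_lt_trans/(_ u0).
    by have /andP[+ _] := real_cdf_bounds nu x; rewrite leNgt => /negP.
  rewrite measure0; apply/esym/eqP; rewrite eq_le measure_ge0 andbT.
  rewrite (@le_trans _ _ (uniform_prob (@ltr01 R) `]-oo, 0%R]%classic))//; last first.
    by rewrite uniform01_ray ?lexx ?ler01.
  rewrite le_measure ?inE// => x /=; rewrite !in_itv/= => /le_trans; apply.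
  exact: ltW.
have [u1|u1] := ltP u 1%R.
  by rewrite atomless_cdf_ray ?u0// uniform01_ray// u0 ltW.
rewrite (_ : _ @^-1` _ = setT); last first.
  apply/seteqP; split => // x _ /=; rewrite in_itv/= (le_trans _ u1)//.
  by have /andP[] := real_cdf_bounds nu x.
rewrite probability_setT; apply/esym/eqP; rewrite eq_le probability_le1//=.
rewrite (@le_trans _ _ (uniform_prob (@ltr01 R) `]-oo, 1%R]%classic))//.
  by rewrite uniform01_ray ?lexx ?ler01.
rewrite le_measure ?inE// => x /=; rewrite !in_itv/= => /le_trans; apply.
exact: u1.
Qed.

End real_laws.

(** * Ball masses and densities *)

Local Open Scope ereal_scope.

Section ball_masses.
Context (R : realType) (D m : nat).
Variables (Theta : set (D.-tuple R)) (phi : D.-tuple R -> m.-tuple R).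
Hypothesis mTheta : measurable Theta.
Hypothesis mphi : measurable_fun Theta phi.

Lemma measurable_tnth_phi i : measurable_fun Theta (fun t => tnth (phi t) i).
Proof. exact: (measurableT_comp (measurable_tnth i) mphi). Qed.

Lemma measurable_dphi tl : measurable_fun Theta (dphi phi tl).
Proof.
have msqrt : measurable_fun setT (@Num.sqrt R).
  by apply: nondecreasing_measurable => // x y; exact: ler_wsqrtr.
apply: (measurableT_comp msqrt).
apply: measurable_sum => i; apply: measurable_funX.
by apply: measurable_funB => //; exact: measurable_tnth_phi.
Qed.

Lemma phi_ballE tl r : phi_ball Theta phi tl r = Theta `&` dphi phi tl @^-1` `]-oo, r]%classic.
Proof. by apply/seteqP; split => t []; rewrite /= in_itv. Qed.

(** Through the law of the distance to [tl], ball masses become a distribution function on the line,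
    and [ball_rank] is that function evaluated at the distance. *)
Lemma distance_law (p : probability (D.-tuple R) R) tl : p Theta = 1 ->
  exists nu : probability R R, [/\ forall r, nu `]-oo, r]%classic = p (phi_ball Theta phi tl r),
    forall B, measurable B -> nu B = p (Theta `&` dphi phi tl @^-1` B) &
    forall h : R -> \bar R, measurable_fun setT h -> (forall y, 0 <= h y) ->
      \int[p]_(x in Theta) h (dphi phi tl x) = \int[nu]_y h y].
Proof.
move=> pT; have [nu [nuE nuI]] := probability_law mTheta pT (measurable_dphi tl).
by exists nu; split => // r; rewrite nuE// phi_ballE.
Qed.

Variables p q : probability (D.-tuple R) R.
Hypothesis (pT : p Theta = 1) (qT : q Theta = 1).

Lemma uniform01_ball_mass tl : uniform01_under Theta p (ball_rank Theta phi q tl) ->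
  forall r, p (phi_ball Theta phi tl r) = q (phi_ball Theta phi tl r).
Proof.
have [nup [nupr nupE _]] := distance_law tl pT.
have [nuq [nuqr nuqE _]] := distance_law tl qT.
move=> unif r; rewrite -nupr -nuqr; apply: cdf_uniform_eq_ray => A mA.
rewrite -unif// nupE; last first.
  by rewrite -[X in measurable X]setTI; exact: (measurable_real_cdf nuq).
congr (p _); apply/seteqP; split => t [Tt]; split => //; move: b;
  by rewrite /= /ball_rank /real_cdf nuqr.
Qed.

Lemma ball_mass_uniform01 tl : atomless_distance Theta phi q tl ->
  (forall r, p (phi_ball Theta phi tl r) = q (phi_ball Theta phi tl r)) ->
  uniform01_under Theta p (ball_rank Theta phi q tl).
Proof.
have [nup [nupr nupE _]] := distance_law tl pT.
have [nuq [nuqr nuqE _]] := distance_law tl qT.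
move=> atomless pq A mA.
have mF : measurable (real_cdf nuq @^-1` A).
  by rewrite -[X in measurable X]setTI; exact: (measurable_real_cdf nuq).
have nuq0 r : nuq [set r] = 0.
  by rewrite nuqE// -[RHS](atomless r); congr (q _); apply/seteqP; split.
have nu_eq r : nuq `]-oo, r]%classic = nup `]-oo, r]%classic by rewrite nuqr nupr pq.
have nuqoo : nuq setT < +oo by rewrite probability_setT ltry.
rewrite -(probability_integral_transform nuq0 mA).
transitivity (nup (real_cdf nuq @^-1` A)).
  rewrite nupE//; congr (p _); apply/seteqP; split => t [Tt]; split => //; move: b;
    by rewrite /= /ball_rank /real_cdf nuqr.
by rewrite (finite_measure_unique_ray nuqoo nu_eq mF).
Qed.

(** A ball of negative radius is empty, and beyond the supremum a ball is all of [Theta], of mass 1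
    under both measures. *)
Lemma same_ball_mass_all_radii tl : Theta tl -> same_ball_mass Theta phi p q tl ->
  forall r, p (phi_ball Theta phi tl r) = q (phi_ball Theta phi tl r).
Proof.
move=> Ttl same r; have [r0|r0] := ltP r 0%R.
  rewrite (_ : phi_ball _ _ _ _ = set0) ?measure0//.
  apply/seteqP; split => // t [_]; rewrite leNgt => /negP; apply.
  by rewrite (lt_le_trans r0)// sqrtr_ge0.
have [rs|rs] := leP r%:E (ereal_sup [set (dphi phi t' tl)%:E | t' in Theta]).
  exact: same.
rewrite (_ : phi_ball _ _ _ _ = Theta); first by rewrite pT qT.
apply/seteqP; split => [t []//|t Tt]; split => //.
rewrite -lee_fin ltW// (le_lt_trans _ rs)//; apply: ereal_sup_ubound.
exists t => //; congr (Num.sqrt _)%:E; apply: eq_bigr => i _.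
by rewrite -sqrrN opprB.
Qed.

(** The integrand is a function of the distance to [tl], whose laws under [p] and [q] agree on rays
    and hence everywhere. *)
Lemma ball_mass_gap tl (c : R) : (0 <= c)%R ->
  (forall r, p (phi_ball Theta phi tl r) = q (phi_ball Theta phi tl r)) ->
  gap Theta p q (fun y =>
    expR (- (c * \sum_(i < m) (tnth (phi tl) i - tnth (phi y) i) ^+ 2)))%R = 0%R.
Proof.
move=> c0 pq; pose h (r : R) : \bar R := (expR (- (c * r ^+ 2)))%:E.
have mh : measurable_fun setT h.
  apply/measurable_EFinP; apply: measurableT_comp => //; apply: measurableT_comp => //.
  by apply: measurable_funM => //; exact: measurable_funX.
have h0 r : 0 <= h r by rewrite lee_fin expR_ge0.
have hE (mu : probability (D.-tuple R) R) : (\int[mu]_(y in Theta)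
    expR (- (c * \sum_(i < m) (tnth (phi tl) i - tnth (phi y) i) ^+ 2)))%R =
    fine (\int[mu]_(y in Theta) h (dphi phi tl y)).
  congr fine; apply: eq_integral => y _; rewrite /h sqr_sqrtr//.
  by apply: sumr_ge0 => i _; exact: sqr_ge0.
have [nup [nupr _ nupI]] := distance_law tl pT.
have [nuq [nuqr _ nuqI]] := distance_law tl qT.
have nupoo : nup setT < +oo by rewrite probability_setT ltry.
have nu_eq r : nup `]-oo, r]%classic = nuq `]-oo, r]%classic by rewrite nuqr nupr pq.
rewrite /gap !hE nupI// nuqI//; apply/eqP; rewrite subr_eq0; apply/eqP; congr fine.
apply: eq_measure_integral => A mA _; exact: (finite_measure_unique_ray nupoo nu_eq mA).
Qed.

Hypothesis phi_inj : forall x y, Theta x -> Theta y -> phi x = phi y -> x = y.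

Lemma ball_mass_unique :
  (forall tl, Theta tl ->
    forall r, p (phi_ball Theta phi tl r) = q (phi_ball Theta phi tl r)) ->
  forall A, measurable A -> A `<=` Theta -> p A = q A.
Proof.
move=> pq; apply: (phi_preimage_unique mTheta mphi phi_inj).
have [nup [nupE nupI]] := probability_law mTheta pT mphi.
have [nuq [nuqE nuqI]] := probability_law mTheta qT mphi.
move=> B mB; rewrite -nupE// -nuqE//.
have nupoo : nup setT < +oo by rewrite probability_setT ltry.
apply: (finite_measure_unique_orthant nupoo) mB => s.
have pqT : p Theta = q Theta by rewrite pT qT.
have gapK (c : R) x : (0 <= c)%R -> Theta x -> gap Theta p q (fun y =>
    expR (- (c * \sum_(i < m) (tnth (phi x) i - tnth (phi y) i) ^+ 2)))%R = 0%R.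
  by move=> c0 Tx; apply: ball_mass_gap => //; exact: pq.
have := gap_orthant mTheta pqT measurable_tnth_phi gapK s.
have mo := measurable_orthant s.
have mI : measurable_fun setT (fun y => (\1_(orthant s) y : R)%:E).
  by apply/measurable_EFinP; exact: measurable_indic.
have I0 y : 0 <= (\1_(orthant s) y : R)%:E by rewrite lee_fin.
rewrite /gap /Rintegral (nupI _ mI I0) (nuqI _ mI I0) !integral_indic// !setIT.
move/eqP; rewrite subr_eq0 => /eqP h.
by rewrite -[LHS]fineK ?fin_num_measure// -[RHS]fineK ?fin_num_measure// h.
Qed.

End ball_masses.

(** * Equality of densities and equality of masses *)

Section densities.
Context (R : realType) (D : nat) (Theta : set (D.-tuple R)).
Hypothesis mTheta : measurable Theta.
Variables p q : probability (D.-tuple R) R.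
Hypotheses (p_ac : p `<< @lebesgue_tuple R D) (q_ac : q `<< @lebesgue_tuple R D).

Local Open Scope charge_scope.

Let densityE (mu : probability (D.-tuple R) R) A : mu `<< @lebesgue_tuple R D ->
  measurable A -> mu A = \int[@lebesgue_tuple R D]_(x in A)
    ('d (charge_of_finite_measure mu) '/d (@lebesgue_tuple R D)) x.
Proof. by move=> mu_ac mA; rewrite -Radon_Nikodym_integral. Qed.

(** By Radon-Nikodym, masses are integrals of the densities, and integrable functions with equal
    integrals over all measurable subsets of [Theta] agree almost everywhere there. *)
Lemma same_densityP : same_density Theta p q <->
  (forall A, measurable A -> A `<=` Theta -> p A = q A).
Proof.
have mf (mu : probability (D.-tuple R) R) A : mu `<< @lebesgue_tuple R D ->
    measurable A -> (@lebesgue_tuple R D).-integrable A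
    ('d (charge_of_finite_measure mu) '/d (@lebesgue_tuple R D)).
  move=> mu_ac mA; apply: (integrableS measurableT) => //.
  exact: Radon_Nikodym_integrable.
split=> [pq A mA AT|pq].
  rewrite (densityE p_ac mA) (densityE q_ac mA); apply: ae_eq_integral => //.
  - by apply: measurable_int; exact: mf.
  - by apply: measurable_int; exact: mf.
  - exact: ae_eq_subset pq.
apply: integral_ae_eq => //.
- exact: mf.
- by apply: measurable_int; exact: mf.
- by move=> E ET mE; rewrite -densityE// -densityE// pq.
Qed.

End densities.

Theorem theorem2 (R : realType) (D m : nat) (Theta : set (D.-tuple R))
    (phi : D.-tuple R -> m.-tuple R) (p q : probability (D.-tuple R) R)
    (mTheta : measurable Theta)
    (mphi : measurable_fun Theta phi)
    (phi_metric : is_metric_on Theta (dphi phi))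
    (phi_doubling : doubling Theta phi)
    (p_Theta : p Theta = 1) (q_Theta : q Theta = 1)
    (p_ac : p `<< @lebesgue_tuple R D)
    (q_ac : q `<< @lebesgue_tuple R D) :
  (forall tl : D.-tuple R, Theta tl ->
     (uniform01_under Theta p (ball_rank Theta phi q tl) ->
        same_ball_mass Theta phi p q tl) /\
     (atomless_distance Theta phi q tl ->
        same_ball_mass Theta phi p q tl ->
        uniform01_under Theta p (ball_rank Theta phi q tl))) /\
  ((forall tl : D.-tuple R, Theta tl ->
      uniform01_under Theta p (ball_rank Theta phi q tl)) ->
     same_density Theta p q) /\
  ((forall tl : D.-tuple R, Theta tl -> atomless_distance Theta phi q tl) ->
     same_density Theta p q ->
     forall tl : D.-tuple R, Theta tl ->
       uniform01_under Theta p (ball_rank Theta phi q tl)).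
Proof.
(* Points with equal images are at distance 0, so separation of the metric gives injectivity. *)
have phi_inj x y : Theta x -> Theta y -> phi x = phi y -> x = y.
  move=> Tx Ty xy; have [_ d0 _ _] := phi_metric; apply/(d0 x y Tx Ty).
  rewrite /dphi xy big1 ?sqrtr0// => i _.
  by rewrite subrr expr0n.
split=> [tl Ttl|]; [split=> [unif r _ _|atomless same]|split=> [unif|atomless pq tl Ttl]].
- exact: uniform01_ball_mass unif r.
- by apply: ball_mass_uniform01 => //; exact: same_ball_mass_all_radii.
- apply/same_densityP => //; apply: (ball_mass_unique mTheta mphi) => // tl Ttl r.
  by apply: uniform01_ball_mass => //; exact: unif.
- apply: ball_mass_uniform01 => //; first exact: atomless.
  (* Balls are measurable subsets of [Theta], so equal densities give them equal masses. *)
  move=> r; move/(same_densityP mTheta p_ac q_ac) : pq; apply; last by move=> t [].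
  by rewrite phi_ballE; exact: (measurable_dphi mphi).
Qed.
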